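(* Let $p$ be an odd prime and $t\ge 2$. Let $\widehat{G_t}=\langle x,y : x^{p^t}=y^{p^t}=1,\ yxy^{-1}=x^{(p-1)p^{t-1}+1}\rangle\cong\mathbb{Z}_{p^t}\rtimes_{(p-1)p^{t-1}+1}\mathbb{Z}_{p^t}$, with the subsets $\widehat{P_{t,i}}$ ($1\le i\le p-1$), $\widehat{S_{t,j}}$ ($0\le j\le p-1$) and $\widehat{S_{t,\infty}}$ defined in the context. Then the collection $\{\widehat{P_{t,1}},\widehat{P_{t,2}},\dots,\widehat{P_{t,p-1}},\widehat{S_{t,0}},\widehat{S_{t,1}},\dots,\widehat{S_{t,p-1}},\widehat{S_{t,\infty}}\}$ is a $2p$-class amorphic association scheme on $\widehat{G_t}$. Therefore, $$\widehat{D_t}=\left(\bigcup_{i=1}^{\frac{p-1}{2}}\widehat{P_{t,i}}\right)\cup\left(\bigcup_{j=0}^{\frac{p-1}{2}}\widehat{S_{t,j}}\right)$$ is a Paley-type $\left(p^{2t},\frac{p^{2t}-1}{2},\frac{p^{2t}-5}{4},\frac{p^{2t}-1}{4}\right)$-partial difference set in $\widehat{G_t}$.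
   Context: A $(v,k,\lambda,\mu)$-partial difference set (PDS) in a finite group $G$ of order $v$ is a subset $D$ with $|D|=k$ such that every nonidentity element of $D$ can be written as $d_1d_2^{-1}$ with $d_1,d_2\in D$ in exactly $\lambda$ ways, and every nonidentity element of $G-D$ in exactly $\mu$ ways. PDSs are assumed regular: $1_G\notin D$ and $D=D^{-1}$. An association scheme with $d$ classes on a finite set $\mathcal{X}$ is a partition of $\mathcal{X}\times\mathcal{X}$ into relations $R_0,\dots,R_d$ such that $R_0$ is the diagonal, the transpose of each $R_\ell$ is some $R_{\ell'}$, and for all $i,j,k$ the number $|\{z:(x,z)\in R_i,(z,y)\in R_j\}|$ is a constant $p_{ij}^k$ for all $(x,y)\in R_k$. It is amorphic if every fusion (partition obtained by replacing the nondiagonal relations by unions of them) is again an association scheme. A collection $\{D_1,\dots,D_d\}$ of subsets partitioning the nonidentity elements of a group $G$ is said to be an association scheme on $G$ via the relations $R_i=\{(g,h)\in G\times G:gh^{-1}\in D_i\}$, $i\ge 1$, together with the diagonal $R_0$. In $\widehat{G_t}$, with $\langle a\rangle$ denoting the cyclic subgroup generated by $a$ and $-$ denoting set difference, for $1\le i\le p-1$ the set $\widehat{P_{t,i}}$ is $$\bigcup_{r=1}^{t-1}\ \bigcup_{j=0}^{p^{r-1}-1}\left(\left(\bigcup_{k=0}^{p-1}\left(\langle xy^{ip^r+pj+k}\rangle-\langle x^{p^{t-r}}y^{jp^{t+1-r}+kp^{t-r}}\rangle\right)\right)\cup\left(\langle x^{ip^r+jp}y\rangle-\langle x^{jp^{t-r+1}}y^{p^{t-r}}\rangle\right)\right),$$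 and $\widehat{S_{t,j}}=\langle xy^j\rangle-\{1\}$ for $0\le j\le p-1$, $\widehat{S_{t,\infty}}=\langle y\rangle-\{1\}$. *)

(* Defs.v *)
From mathcomp Require Import all_boot all_fingroup all_solvable.

Set Implicit Arguments.
Unset Strict Implicit.
Unset Printing Implicit Defensive.

Local Open Scope group_scope.

Section PartialDifferenceSets.

Variable gT : finGroupType.
Implicit Types (G : {group gT}) (D : {set gT}) (g : gT).

Definition num_quot D g : nat :=
  #|[set d in setX D D | d.1 * d.2^-1 == g]|.

Definition pds G D (v k lambda mu : nat) : Prop :=
  [/\ D \subset G, #|G| = v, #|D| = k,
      {in D, forall g, g != 1 -> num_quot D g = lambda} &
      {in G :\: D, forall g, g != 1 -> num_quot D g = mu}].

Definition regular_pds G D (v k lambda mu : nat) : Prop :=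
  [/\ pds G D v k lambda mu, 1 \notin D & D^-1 = D].

End PartialDifferenceSets.

(* A family of relations on the finite set X is represented by the set of     *)
(* its members; mathcomp's partition requires the members to be nonempty, so  *)
(* a scheme with d classes has exactly d + 1 members, counting the diagonal.  *)
Section AssociationSchemes.

Variable T : finType.
Implicit Types (X : {set T}) (R : {set T * T}) (A : {set {set T * T}}).

Definition diag X : {set T * T} := [set (x, x) | x in X].

Definition transp R : {set T * T} := [set (xy.2, xy.1) | xy in R].

Definition inter_num X R1 R2 (x y : T) : nat :=
  #|[set z in X | ((x, z) \in R1) && ((z, y) \in R2)]|.

Definition assoc_scheme X A : Prop :=
  [/\ partition A (setX X X),
      diag X \in A,
      {in A, forall R, transp R \in A} &
      {in A & A & A, forall R1 R2 R3, exists c : nat,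
         forall x y, (x, y) \in R3 -> inter_num X R1 R2 x y = c}].

Definition num_classes A (d : nat) : Prop := #|A| = d.+1.

(* The blocks of P are the sets of nondiagonal relations merged together. *)
Definition fusion X (P : {set {set {set T * T}}}) : {set {set T * T}} :=
  diag X |: [set cover B | B : {set {set T * T}} in P].

Definition amorphic X A : Prop :=
  forall P : {set {set {set T * T}}},
    partition P (A :\ diag X) -> assoc_scheme X (fusion X P).

End AssociationSchemes.

Section GroupSchemes.

Variable gT : finGroupType.
Implicit Types (G : {group gT}) (D : {set gT}) (Ds : {set {set gT}}).

Definition group_rel G D : {set gT * gT} :=
  [set gh in setX G G | gh.1 * gh.2^-1 \in D].

Definition group_rels G Ds : {set {set gT * gT}} :=
  diag G |: [set group_rel G D | D : {set gT} in Ds].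

Definition amorphic_scheme_on_group G Ds (d : nat) : Prop :=
  [/\ partition Ds G^#,
      assoc_scheme G (group_rels G Ds),
      num_classes (group_rels G Ds) d &
      amorphic G (group_rels G Ds)].

End GroupSchemes.

Section Construction.

Variables (p t : nat) (gT : finGroupType).

Definition twist : nat := ((p - 1) * p ^ (t - 1) + 1)%N.

(* The isog Grp clause only says that some pair of generators of G gives the  *)
(* presentation. Since G is finite, any pair (x, y) that generates G and      *)
(* satisfies the relations then presents G too: the induced epimorphism       *)
(* between groups of equal order is injective.                                *)
Definition Ghat_spec (G : {group gT}) (x y : gT) : Prop :=
  G \isog Grp (a : b : a ^+ (p ^ t)%N, b ^+ (p ^ t)%N,
                       b * a * b^-1 = a ^+ twist)
  /\ [/\ <[x]> <*> <[y]> = G,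
         x ^+ (p ^ t)%N = 1,
         y ^+ (p ^ t)%N = 1 &
         y * x * y^-1 = x ^+ twist].

(* Given the action y * x * y^-1 = x ^+ twist, this is the internal form of   *)
(* the semidirect product decomposition Z_(p^t) ><| Z_(p^t).                  *)
Definition Ghat_sdprod (G : {group gT}) (x y : gT) : Prop :=
  [/\ <[x]> ><| <[y]> = G,
      #[x] = (p ^ t)%N,
      #[y] = (p ^ t)%N &
      y * x * y^-1 = x ^+ twist].

Variables x y : gT.

Definition Phat (i : nat) : {set gT} :=
  \bigcup_(1 <= r < t) \bigcup_(0 <= j < p ^ (r - 1))
    ((\bigcup_(0 <= k < p)
        (<[x * y ^+ (i * p ^ r + p * j + k)%N]>
         :\: <[x ^+ (p ^ (t - r))%N *
               y ^+ (j * p ^ (t + 1 - r) + k * p ^ (t - r))%N]>))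
     :|: (<[x ^+ (i * p ^ r + j * p)%N * y]>
          :\: <[x ^+ (j * p ^ (t - r + 1))%N * y ^+ (p ^ (t - r))%N]>)).

Definition Shat (j : nat) : {set gT} := <[x * y ^+ j]> :\ 1.

Definition Shat_inf : {set gT} := <[y]> :\ 1.

Definition Ghat_classes : {set {set gT}} :=
  [set Phat i | i : 'I_p & (1 <= i)%N]
  :|: [set Shat j | j : 'I_p]
  :|: [set Shat_inf].

Definition Dhat : {set gT} :=
  (\bigcup_(1 <= i < ((p - 1) %/ 2).+1) Phat i)
  :|: (\bigcup_(0 <= j < ((p - 1) %/ 2).+1) Shat j).

End Construction.

(* Main.v *)
Require Import Defs.
From mathcomp Require Import all_boot all_fingroup all_solvable.
From mathcomp Require Import all_order all_algebra.
From mathcomp Require Import zify ring lra.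

(** The group G has class 2, with a central commutator subgroup of order p, and
    p is odd; hence p-power maps are endomorphisms, and the cyclic subgroups of
    G meet and multiply as those of Z_q x Z_q do, where q = p^t. More precisely
    (mul_leaf), if C and C' are maximal cyclic subgroups, of order q, whose
    intersection has order p^s, then C C' = C Om(t - s), where Om(m) denotes the
    normal subgroup of elements of order at most p^m.

    The cyclic subgroups form a tree: those of order p^m correspond to the
    points of the projective line over Z/p^m. Each of the p + 1 nodes of level 1
    carries one of the labels S_0, ..., S_(p-1), S_inf, and the label of a
    higher node is that of its parent if its new digit is 0, and P_d if its new
    digit is d > 0. In these terms each of the sets of the theorem consists of
    the nontrivial elements g such that the node generated by g has a given
    label (Phat_class, Shat_class, Shat_inf_class).

    In the group algebra, the set D_k of label k is the sum over the nodes v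
    labelled k of C(v) - C(v'), where C(v) is the cyclic subgroup v and v' its
    parent. A node passes each label P_d to its child of digit d, and its own
    label to its child of digit 0; so, once the terms are collected, the
    coefficient of an inner node does not depend on its label, and for a
    suitable integer n_k
      f_k = D_k + n_k = (sum of the leaves labelled k) - [k is a P-label] Z,
    where Z is a fixed combination of the subgroups Om(m), 0 < m < t
    (f_label_class). The idempotents attached to the chain of the Om(m) cut the
    group algebra into pieces. On the piece of the characters trivial on Om(m)
    but not on Om(m + 1), leaves over distinct nodes of level t - m are
    orthogonal, and f_k acts on a leaf C as q if the node of level t - m of C
    is labelled k, and as 0 otherwise (C_delta_f). So f_k f_l vanishes for
    k <> l on all these pieces, and f_k f_l = n_k n_l G (f_mul).

    This identity says that the D_k are a family of Latin square type. As the
    f_k sum up to G + q, it implies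
      f_A f_B = q f_(A & B) + (n_A n_B - n_(A & B)) G
    for all sets A and B of labels, with f_A and n_A the sums over A
    (unions_mul). The coefficients of a product of two unions of classes are
    thus constant on the blocks of any coarser partition: all fusions are
    association schemes. Finally the union of the P_i with 0 < i <= (p - 1) / 2
    and of the S_j with 0 <= j <= (p - 1) / 2 has n = (q + 1) / 2, and the same
    formula gives the parameters of Paley type. *)

Set Implicit Arguments.
Unset Strict Implicit.
Unset Printing Implicit Defensive.

Import GRing.Theory Num.Theory.
Local Open Scope group_scope.

(** * The group algebra as convolution matrices *)

Section Convolution.

Variable gT : finGroupType.
Implicit Types (A B : {set gT}) (H K G : {group gT}) (g : gT).

Definition gquo (i j : 'I_#|gT|) : gT := enum_val i * (enum_val j)^-1.

(** The image of the formal sum of A under the regular representation, so that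
    matrix products compute products in the group algebra; for A inside G it is
    also the adjacency matrix of the relation attached to A. *)
Definition conv A : 'M[rat]_#|gT| :=
  (\matrix_(i, j) (gquo i j \in A)%:R)%R.

(** The coefficient of g in the group algebra product of A and B. *)
Definition prod_count A B g : nat := #|[set w in B | g * w^-1 \in A]|.

Lemma convE A i j : conv A i j = ((gquo i j \in A)%:R)%R.
Proof. by rewrite mxE. Qed.

Lemma conv_mulE A B i j :
  (conv A *m conv B)%R i j = ((prod_count A B (gquo i j))%:R)%R.
Proof.
rewrite mxE /prod_count -sum1_card natr_sum [RHS]big_mkcond /=.
rewrite [RHS](reindex_inj (mulIg (enum_val j)^-1)) /=.
rewrite (reindex _ (onW_bij _ (@enum_rank_bij gT))) /=; apply: eq_bigr => z _.
rewrite !convE /gquo inE enum_rankK invMg invgK mulgA mulgKV.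
by case: (_ \in A); case: (_ \in B); rewrite /= ?mul0r ?mulr0 ?mulr1.
Qed.

Lemma conv1 : conv 1 = 1%:M%R.
Proof.
apply/matrixP=> i j; rewrite convE mxE inE /gquo -eq_mulgV1.
by rewrite (inj_eq enum_val_inj).
Qed.

(** A product h k is reached once for each element of the intersection, even
    when the set H K is not a subgroup. This is what lets a nonabelian group
    behave like Z_q x Z_q. *)
Lemma convM_group H K :
  (conv H *m conv K = #|H :&: K|%:R *: conv (H * K)%g)%R.
Proof.
apply/matrixP=> i j; rewrite conv_mulE mxE convE; set g := gquo i j.
have [/mulsgP[h k Hh Kk ->] | nHKg] := boolP (g \in _); last first.
  rewrite mulr0 (_ : prod_count _ _ _ = 0)%N //; apply: eq_card0 => w.
  rewrite !inE; apply/negP=> /andP[Kw Hgw]; case/negP: nHKg.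
  by apply/mulsgP; exists (g * w^-1) w; rewrite ?mulgKV.
rewrite mulr1; congr (_%:R)%R; rewrite /prod_count -[RHS](card_rcoset _ k).
apply: eq_card => w; rewrite [LHS]inE mem_rcoset in_setI.
have -> : (w * k^-1 \in K) = (w \in K) by rewrite groupMr ?groupV.
rewrite andbC -mulgA groupMl //; congr (_ && _).
by rewrite -groupV invMg invgK.
Qed.

Lemma convMG A G : A \subset G -> (conv A *m conv G = #|A|%:R *: conv G)%R.
Proof.
move=> sAG; apply/matrixP=> i j; rewrite conv_mulE mxE convE; set g := gquo i j.
have [Gg | nGg] := boolP (g \in G); last first.
  rewrite mulr0 (_ : prod_count _ _ _ = 0)%N //; apply: eq_card0 => w.
  rewrite !inE; apply/negP=> /andP[Gw Agw]; case/negP: nGg.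
  by rewrite -[g](mulgKV w) groupM // (subsetP sAG).
rewrite mulr1; congr (_%:R)%R.
have inj_h : injective (fun a => a^-1 * g) by move=> a b /mulIg/invg_inj.
rewrite /prod_count -(card_imset A inj_h); apply: eq_card => w; rewrite inE.
apply/andP/imsetP=> [[Gw Aw] | [a Aa ->]].
  by exists (g * w^-1); rewrite // invMg invgK mulgKV.
by rewrite invMg invgK mulKVg groupM // groupV (subsetP sAG).
Qed.

End Convolution.

(** * Association schemes carried by a partition of a group *)

Section SchemesFromClasses.

Variables (gT : finGroupType) (G : {group gT}).
Implicit Types (A B C : {set gT}) (Ds Es : {set {set gT}}) (g h : gT).

Lemma mem_group_rel A g h :
  ((g, h) \in group_rel G A) = [&& g \in G, h \in G & g * h^-1 \in A].
Proof. by rewrite !inE /= -andbA. Qed.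

Lemma group_rel1 : group_rel G 1 = diag G.
Proof.
apply/setP=> [[g h]]; rewrite mem_group_rel inE -eq_mulgV1.
apply/and3P/imsetP=> [[Gg _ /eqP <-] | [u Gu [-> ->]]]; first by exists g.
by split.
Qed.

Lemma group_relsE Ds : group_rels G Ds = group_rel G @: (1%g |: Ds).
Proof. by rewrite imsetU1 group_rel1. Qed.

Lemma mem_group_rel_1 A g : A \subset G ->
  ((g, 1) \in group_rel G A) = (g \in A).
Proof.
move=> sAG; rewrite mem_group_rel group1 invg1 mulg1 /=.
by apply: andb_idl; apply: (subsetP sAG).
Qed.

Lemma group_rel_inj A B :
  A \subset G -> B \subset G -> group_rel G A = group_rel G B -> A = B.
Proof.
by move=> sAG sBG eqAB; apply/setP=> g; rewrite -!mem_group_rel_1 // eqAB.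
Qed.

Lemma num_quot_prod_count A g : A^-1 = A -> num_quot A g = prod_count A A g.
Proof.
move=> symA.
have inj_h : injective (fun w => (g * w^-1, w^-1)).
  by move=> u v [_ /invg_inj].
rewrite /num_quot /prod_count -(card_imset _ inj_h); apply: eq_card => [[a b]].
rewrite inE; apply/andP/imsetP=> [[/setXP[Aa Ab] /= /eqP defg]|].
  exists b^-1; last by rewrite invgK -defg mulgKV.
  by rewrite inE -{1}symA inE invgK Ab -defg mulgKV.
case=> w /setIdP[Aw Agw] [-> ->]; rewrite inE /= Agw invgK mulgKV eqxx.
by rewrite -symA inE invgK Aw.
Qed.

Lemma inter_numE A B g h :
    A \subset G -> B \subset G -> g \in G -> h \in G ->
  inter_num G (group_rel G A) (group_rel G B) g h = prod_count A B (g * h^-1).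
Proof.
move=> sAG sBG Gg Gh; rewrite /prod_count /inter_num -[RHS](card_rcoset _ h).
apply: eq_card => z; rewrite inE !mem_group_rel Gg Gh mem_rcoset inE /=.
rewrite invMg invgK mulgA mulgKV; case Gz: (z \in G) => /=.
  by rewrite andbC.
apply/esym/negP=> /andP[/(subsetP sBG)]; rewrite groupMr ?groupV //.
by rewrite Gz.
Qed.

Lemma partition_group_rels Es :
  partition Es G -> partition (group_rel G @: Es) (setX G G).
Proof.
case/and3P=> /eqP defEs /trivIsetP tiEs Es'0.
have sEG A : A \in Es -> A \subset G.
  by move=> EsA; rewrite -defEs; apply: bigcup_sup EsA.
apply/and3P; split.
- apply/eqP/setP=> [[g h]]; rewrite inE /=; apply/bigcupP/andP=> [[R]|[Gg Gh]].
    by case/imsetP=> A _ ->; rewrite mem_group_rel => /and3P[].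
  have: g * h^-1 \in cover Es by rewrite defEs groupM ?groupV.
  case/bigcupP=> A EsA Agh; exists (group_rel G A); first exact: imset_f.
  by rewrite mem_group_rel Gg Gh.
- apply/trivIsetP=> _ _ /imsetP[A EsA ->] /imsetP[B EsB ->] neqAB.
  have {}neqAB: A != B by apply: contraNneq neqAB => ->.
  apply/pred0P=> [[g h]] /=; rewrite !mem_group_rel; apply/negP.
  case/andP=> /and3P[_ _ Agh] /and3P[_ _ Bgh].
  by have /pred0P/(_ (g * h^-1)) := tiEs A B EsA EsB neqAB; rewrite /= Agh Bgh.
apply/imsetP=> [[A EsA] /esym/eqP]; apply/negP.
have /set0Pn[g Ag] : A != set0 by apply: contraNneq Es'0 => <-.
by apply/set0Pn; exists (g, 1); rewrite mem_group_rel_1 // sEG.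
Qed.

(** The diagonal relation is the relation of the class {1}, so that the
    relations of a scheme are those of a partition of the whole of G. *)
Lemma partition_with_1 Es : partition Es G^# -> partition (1%g |: Es) G.
Proof.
move=> partEs; rewrite -[X in partition _ X](setD1K (group1 G)).
apply: partitionU1 => //; first by apply/set0Pn; exists 1; rewrite inE.
by rewrite disjoints1 !inE eqxx.
Qed.

(** Intersection numbers are coefficients of products in the group algebra; the
    hypothesis asks them to be constant on each class, and only for the classes
    other than {1}, where the constancy is not automatic. *)
Lemma assoc_scheme_of_partition Es :
    partition Es G^# -> {in Es, forall A, A^-1 = A} ->
    {in Es & Es & Es, forall A B C,
       {in C &, forall g h, prod_count A B g = prod_count A B h}} ->
  assoc_scheme G (group_rels G Es).
Proof.
move=> partEs symEs constEs; have partE1 := partition_with_1 partEs.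
have [/eqP defE1 tiE1 _] := and3P partE1; pose Es1 := 1%g |: Es.
have sEG A : A \in Es1 -> A \subset G.
  by move=> EsA; rewrite -defE1; apply: bigcup_sup EsA.
have symE1 A : A \in Es1 -> A^-1 = A.
  by case/setU1P=> [-> | /symEs //]; apply/setP=> g; rewrite !inE invg_eq1.
have memE A B g : A \in Es1 -> B \in Es1 -> g \in B -> (g \in A) = (A == B).
  move=> EsA EsB Bg; apply/idP/eqP=> [Ag | -> //].
  by rewrite -(def_pblock tiE1 EsA Ag) -(def_pblock tiE1 EsB Bg).
have n1l B g : prod_count 1 B g = (g \in B).
  rewrite /prod_count -sum1dep_card big_mkcond (bigD1 g) //= mulgV group1 andbT.
  rewrite big1 ?addn0 => [|w nwg]; first by case: (g \in B).
  by rewrite inE -eq_mulgV1 eq_sym (negPf nwg) andbF.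
have n1r A g : prod_count A 1 g = (g \in A).
  rewrite /prod_count -sum1dep_card big_mkcond (bigD1 1) //= group1 invg1 mulg1
    /=.
  rewrite big1 ?addn0 => [|w nw1]; first by case: (g \in A).
  by rewrite inE (negPf nw1).
(* The class {1} is the unit of the group algebra, hence n1l and n1r. *)
rewrite group_relsE; split.
- exact: partition_group_rels.
- by rewrite -group_rel1 imset_f // setU11.
- move=> _ /imsetP[A EsA ->]; apply/imsetP; exists A => //.
  apply/setP=> [[g h]]; apply/imsetP/idP=> [[[u v] + [-> ->]]|].
    rewrite !mem_group_rel => /and3P[-> ->] /=.
    by rewrite -{2}(symE1 A) // inE invMg invgK.
  rewrite mem_group_rel => /and3P[Gg Gh Agh]; exists (h, g) => //.
  by rewrite mem_group_rel Gg Gh -(symE1 A) // inE invMg invgK.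
move=> _ _ _ /imsetP[A EsA ->] /imsetP[B EsB ->] /imsetP[C EsC ->].
have constE : {in C &, forall g h, prod_count A B g = prod_count A B h}.
  move=> g h Cg Ch; case/setU1P: (EsA) => [-> | EA].
    by rewrite !n1l !(memE B C).
  case/setU1P: (EsB) => [-> | EB]; first by rewrite !n1r !(memE A C).
  case/setU1P: (EsC) Cg Ch => [-> /set1P-> /set1P-> // | EC Cg Ch].
  exact: (constEs A B C).
have /set0Pn[c Cc] : C != set0.
  by apply: contraTneq EsC => ->; rewrite (partition0 partE1).
exists (prod_count A B c) => g h; rewrite mem_group_rel => /and3P[Gg Gh Cgh].
by rewrite inter_numE ?sEG //; apply: constE.
Qed.

Lemma card_group_rels Ds : partition Ds G^# -> #|group_rels G Ds| = #|Ds|.+1.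
Proof.
move=> partDs; have [/eqP defE1 _ _] := and3P (partition_with_1 partDs).
have sEG A : A \in 1%g |: Ds -> A \subset G.
  by move=> EsA; rewrite -defE1; apply: bigcup_sup EsA.
rewrite group_relsE card_in_imset => [|A B EsA EsB]; last first.
  by apply: group_rel_inj; apply: sEG.
rewrite cardsU1 (_ : (1%g \notin Ds) = true) ?add1n //; apply/negP=> Ds1.
have: (1 : gT) \in cover Ds by apply/bigcupP; exists 1%g; rewrite ?group1.
by rewrite (cover_partition partDs) !inE eqxx.
Qed.

(** Merging relations merges the underlying subsets of the group, so every
    fusion is the family of relations of a coarser partition. *)
Lemma fusion_group_rels Ds P :
    partition Ds G^# -> partition P (group_rels G Ds :\ diag G) ->
  exists Es : {set {set gT}},
    [/\ fusion G P = group_rels G Es, partition Es G^# &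
        {in Es, forall A, exists2 Bs : {set {set gT}},
           Bs \subset Ds & A = cover Bs}].
Proof.
move=> partDs partP; have [/eqP defDs tiDs Ds'0] := and3P partDs.
have [/eqP defP tiP P'0] := and3P partP.
have sDG A : A \in Ds -> A \subset G^#.
  by move=> DsA; rewrite -defDs; apply: bigcup_sup DsA.
have sDG1 A : A \in Ds -> A \subset G.
  by move/sDG/subset_trans; apply; apply: subD1set.
have nt_D A : A \in Ds -> A != set0 by apply: contraTneq => ->.
have memP R : (R \in cover P) = (R \in group_rel G @: Ds).
  rewrite defP in_setD1 /group_rels in_setU1.
  case: eqP => //= ->; apply/esym/negP => /imsetP[A DsA].
  rewrite -group_rel1 => /(group_rel_inj (sub1G G) (sDG1 A DsA)) defA.
  by have /subsetP/(_ 1) := sDG A DsA; rewrite -defA !inE eqxx => /(_ isT).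
pose F (B : {set {set gT * gT}}) := [set D in Ds | group_rel G D \in B].
have inP (B : {set {set gT * gT}}) R :
    B \in P -> R \in B -> exists2 A, A \in Ds & R = group_rel G A.
  move=> PB BR; have: R \in cover P by apply/bigcupP; exists B.
  by rewrite memP => /imsetP.
have coverF (B : {set {set gT * gT}}) :
    B \in P -> cover B = group_rel G (cover (F B)).
  move=> PB; apply/setP=> [[g h]]; rewrite mem_group_rel.
  apply/bigcupP/and3P=> [[R BR] | [Gg Gh /bigcupP[A]]].
    have [A DsA defR] := inP B R PB BR; rewrite defR mem_group_rel.
    case/and3P=> -> -> Agh; split=> //; apply/bigcupP; exists A => //.
    by rewrite inE DsA -defR.
  rewrite inE => /andP[DsA BA] Agh; exists (group_rel G A) => //.
  by rewrite mem_group_rel Gg Gh.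
exists [set cover (F B) | B in P]; split.
- rewrite /fusion /group_rels -imset_comp; congr (_ |: _).
  exact: eq_in_imset.
- apply/and3P; split.
  + rewrite cover_imset -defDs; apply/eqP/setP=> g.
    apply/bigcupP/bigcupP=> [[B PB /bigcupP[A]] | [A DsA Ag]].
      by rewrite inE => /andP[DsA _] Ag; exists A.
    have: group_rel G A \in cover P by rewrite memP imset_f.
    case/bigcupP=> B PB BA; exists B => //; apply/bigcupP; exists A => //.
    by rewrite inE DsA.
  + apply/trivIsetP=> _ _ /imsetP[B PB ->] /imsetP[B' PB' ->] neqB.
    apply/pred0P=> g /=; apply: contraNF neqB.
    case/andP=> /bigcupP[A /setIdP[DsA BA] Ag] /bigcupP[A' /setIdP[DsA' BA']
      A'g].
    have eqA : A = A'.
      by rewrite -(def_pblock tiDs DsA Ag) -(def_pblock tiDs DsA' A'g).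
    rewrite -eqA in BA'.
    by rewrite -(def_pblock tiP PB BA) -(def_pblock tiP PB' BA').
  apply/imsetP=> [[B PB /esym/eqP]]; apply/negP.
  have /set0Pn[R BR] : B != set0 by apply: contraNneq P'0 => <-.
  have [A DsA defR] := inP B R PB BR; have /set0Pn[g Ag] := nt_D A DsA.
  by apply/set0Pn; exists g; apply/bigcupP; exists A; rewrite // inE DsA -defR.
move=> _ /imsetP[B _ ->]; exists (F B) => //.
by apply/subsetP=> A; rewrite inE => /andP[].
Qed.

End SchemesFromClasses.

(** * Families of Latin square type *)

Section LatinSquareType.

Variables (gT : finGroupType) (G : {group gT}) (K : finType).
Variables (D : K -> {set gT}) (n : K -> rat) (q : nat).

Hypothesis q_gt1 : (1 < q)%N.
Hypothesis oG : #|G| = (q ^ 2)%N.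
Hypothesis defG : \bigcup_k D k = G^#.
Hypothesis tiD : forall k l g, g \in D k -> g \in D l -> k = l.
Hypothesis symD : forall k, (D k)^-1 = D k.
Hypothesis oD : forall k, (#|D k|%:R = n k * (q%:R - 1))%R.
(** If G is abelian this says that a nontrivial character vanishes on all the
    elements D k + n k but at most one. *)
Hypothesis prodD : forall k l, k != l ->
  ((conv (D k) + (n k)%:M) *m (conv (D l) + (n l)%:M)
   = (n k * n l) *: conv G)%R.

Let f k : 'M[rat]_#|gT| := (conv (D k) + (n k)%:M)%R.
Let J : 'M[rat]_#|gT| := conv G.
Let E (I : {set K}) := \bigcup_(k in I) D k.
Let N (I : {set K}) : rat := (\sum_(k in I) n k)%R.
Implicit Types (I : {set K}) (g : gT).

Lemma sub_class k : D k \subset G^#.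
Proof. by rewrite -defG (bigcup_sup k). Qed.

Lemma mem_unions (I : {set K}) g :
  (((g \in E I)%:R : rat) = \sum_(k in I) (g \in D k)%:R)%R.
Proof.
have [/bigcupP[k Ik Dg] | nEg] := boolP (g \in E I).
  rewrite (bigD1 k) //= Dg big1 ?addr0 // => l /andP[_ nlk].
  case: (boolP (g \in D l)) => // Dlg; case/eqP: nlk; exact: tiD Dlg Dg.
rewrite big1 // => k Ik; case: (boolP (g \in D k)) => // Dg.
by case/negP: nEg; apply/bigcupP; exists k.
Qed.

Lemma sum_mem g : (\sum_k (g \in D k)%:R = (g \in G^#)%:R :> rat)%R.
Proof.
have := mem_unions setT g; rewrite (_ : E setT = G^#) => [->|].
  by apply: eq_bigl => k; rewrite inE.
by rewrite -defG /E; apply: eq_bigl => k; rewrite inE.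
Qed.

Lemma sum_classes : (\sum_k f k = J + (\sum_k n k - 1)%:M)%R.
Proof.
rewrite /f big_split /= -(raddf_sum (@scalar_mx rat #|gT|)) /=.
rewrite raddfB /= [RHS]addrCA addrC; congr (_ + _)%R.
apply/matrixP=> i j; rewrite summxE !mxE; set g := gquo i j.
under eq_bigr do rewrite convE.
rewrite sum_mem !inE /g /gquo -eq_mulgV1 (inj_eq enum_val_inj).
case: eqP => [-> | _] /=; first by rewrite mulgV group1 subrr.
by rewrite subr0.
Qed.

Lemma q_neq1 : (q%:R - 1 != 0 :> rat)%R.
Proof. by rewrite subr_eq0 (eqr_nat _ q 1); case: q q_gt1 => [|[]]. Qed.

Lemma sum_degrees : (\sum_k n k = q%:R + 1)%R.
Proof.
apply: (mulIf q_neq1); rewrite mulr_suml.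
under eq_bigr do rewrite -oD.
rewrite -natr_sum (_ : (\sum_k #|D k|)%N = #|G^#|).
  have -> : #|G^#| = (q ^ 2 - 1)%N.
    by rewrite -oG (cardsD1 1%g G) group1 addKn.
  by rewrite natrB ?expn_gt0 ?(ltnW q_gt1) // natrX; ring.
apply/eqP; rewrite -(eqr_nat rat) natr_sum; apply/eqP.
have natr_card (A : {set gT}) : (#|A|%:R = \sum_g (g \in A)%:R :> rat)%R.
  rewrite -sum1_card natr_sum big_mkcond /=.
  by apply: eq_bigr => g _; case: (g \in A).
under eq_bigr do rewrite natr_card.
by rewrite exchange_big natr_card; apply: eq_bigr => g _; rewrite sum_mem.
Qed.

Lemma classMJ k : (f k *m J = (n k * q%:R) *: J)%R.
Proof.
rewrite mulmxDl convMG ?(subset_trans (sub_class k)) ?subD1set // oD.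
by rewrite mul_scalar_mx -scalerDl; congr (_ *: _)%R; ring.
Qed.

(** The sum of all the elements f k is J + q, so the square of f k follows from
    its products with the other ones. *)
Lemma class_sqr k :
  (f k *m f k = q%:R *: f k + (n k ^+ 2 - n k) *: J)%R.
Proof.
have := congr1 (mulmx (f k)) sum_classes.
rewrite sum_degrees addrK mulmxDr mul_mx_scalar classMJ mulmx_sumr.
rewrite (bigD1 k) //= => /(canRL (addrK _)) ->.
under eq_bigr => l nlk do rewrite prodD 1?eq_sym //.
rewrite -scaler_suml -mulr_sumr addrAC addrC; congr (_ + _)%R.
have := sum_degrees; rewrite (bigD1 k) //= => /(canRL (addKr _)) ->.
by rewrite -scalerBl; congr (_ *: _)%R; ring.
Qed.

Lemma class_mul k l :
  (f k *m f l = (k == l)%:R *: (q%:R *: f k - n k *: J) + (n k * n l) *: J)%R.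
Proof.
have [-> | nkl] := eqVneq; last by rewrite prodD // scale0r add0r.
rewrite class_sqr scale1r scalerBl expr2 -addrA; congr (_ + _)%R.
by rewrite addrC.
Qed.

(** The multiplication table has the same shape for all the unions of classes;
    this is the reason for amorphicity. *)
Lemma unions_mul I I' :
  ((\sum_(k in I) f k) *m (\sum_(l in I') f l)
   = q%:R *: (\sum_(k in I :&: I') f k) + (N I * N I' - N (I :&: I')) *: J)%R.
Proof.
have mul1 k : (f k *m (\sum_(l in I') f l)
    = (k \in I')%:R *: (q%:R *: f k - n k *: J) + (n k * N I') *: J)%R.
  rewrite mulmx_sumr; under eq_bigr do rewrite class_mul.
  rewrite big_split /= -!scaler_suml -mulr_sumr; congr (_ *: _ + _)%R.
  have [I'k | nI'k] := boolP (k \in I').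
    rewrite (bigD1 k) //= eqxx big1 ?addr0 // => l /andP[_ /negPf].
    by rewrite eq_sym => ->.
  by rewrite big1 // => l I'l; case: eqP => // kl; rewrite kl I'l in nI'k.
rewrite mulmx_suml; under eq_bigr do rewrite mul1.
rewrite big_split /= -scaler_suml -mulr_suml scalerBl addrCA addrC.
congr (_ + _)%R.
rewrite (bigID (mem I')) /= [X in (_ + X)%R]big1 ?addr0 => [|k /andP[_ nI'k]].
  rewrite scaler_sumr /N scaler_suml -sumrB.
  rewrite (eq_bigl [in I :&: I']) => [|k]; last by rewrite inE.
  by apply: eq_bigr => k /setIP[_ ->]; rewrite scale1r.
by rewrite (negPf nI'k) scale0r.
Qed.

Lemma sum_f I : (\sum_(k in I) f k = conv (E I) + (N I)%:M)%R.
Proof.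
rewrite /f big_split /= -(raddf_sum (@scalar_mx rat #|gT|)) /=.
congr (_ + _)%R; apply/matrixP=> i j; rewrite summxE convE mem_unions.
by under eq_bigr do rewrite convE.
Qed.

(** The right-hand side depends on g only through its membership in the two
    unions and in their intersection. *)
Lemma prod_count_unions I I' g : g \in G^# ->
  ((prod_count (E I) (E I') g)%:R
   = N I * N I' - N (I :&: I') + q%:R * (g \in E (I :&: I'))%:R
     - N I' * (g \in E I)%:R - N I * (g \in E I')%:R)%R.
Proof.
case/setD1P=> nt_g Gg.
have gE : gquo (enum_rank g) (enum_rank 1) = g.
  by rewrite /gquo !enum_rankK invg1 mulg1.
have g1 : (enum_rank g == enum_rank 1) = false.
  by rewrite (inj_eq enum_rank_inj) (negPf nt_g).
have := unions_mul I I'; rewrite !sum_f mulmxDl !mulmxDr.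
rewrite mul_scalar_mx !mul_mx_scalar scale_scalar_mx.
move/matrixP/(_ (enum_rank g) (enum_rank 1)).
have := conv_mulE (E I) (E I') (enum_rank g) (enum_rank 1).
rewrite gE; move: (conv _ *m conv _)%R => EE EEg.
rewrite !mxE {}EEg gE g1 Gg !mulr0n !addr0 !mulr1 => e.
apply: (addIr (N I' * (g \in E I)%:R + N I * (g \in E I')%:R)%R).
rewrite -!addrA in e *; rewrite {}e; ring.
Qed.

Lemma mem_unionsI I I' g :
  (g \in E (I :&: I')) = (g \in E I) && (g \in E I').
Proof.
apply/bigcupP/andP=> [[k /setIP[Ik I'k] Dg] | [/bigcupP[k Ik Dg]]].
  by split; apply/bigcupP; exists k.
by case/bigcupP=> l I'l /(tiD Dg) kl; exists k; rewrite // inE Ik kl.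
Qed.

Lemma unions_inv I : (E I)^-1 = E I.
Proof.
apply/setP=> g; rewrite inE; apply/bigcupP/bigcupP=> [] [k Ik Dg];
  exists k => //.
  by rewrite -symD inE.
by rewrite -symD inE invgK.
Qed.

Lemma sub_unions I : E I \subset G^#.
Proof. by apply/bigcupsP=> k _; apply: sub_class. Qed.

Lemma card_unions I : (#|E I|%:R = N I * (q%:R - 1) :> rat)%R.
Proof.
rewrite mulr_suml; under eq_bigr do rewrite -oD.
rewrite -sum1_card natr_sum big_mkcond /=.
under [RHS]eq_bigr do rewrite -sum1_card natr_sum big_mkcond.
rewrite exchange_big; apply: eq_bigr => g _ /=.
have -> : ((if g \in E I then 1 else 0) = (g \in E I)%:R :> rat)%R.
  by case: ifP.
by rewrite mem_unions; apply: eq_bigr => k _; case: ifP.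
Qed.

(** Inside one block of Es, membership in any union of blocks is constant, and
    the intersection of two blocks is empty or a block. *)
Lemma scheme_unions (Es : {set {set gT}}) :
    partition Es G^# -> {in Es, forall A, exists I, A = E I} ->
  assoc_scheme G (group_rels G Es).
Proof.
move=> partEs unionEs; apply: assoc_scheme_of_partition => //.
  by move=> A /unionEs[I ->]; rewrite unions_inv.
move=> A B C EsA EsB EsC g h Cg Ch; have [/eqP defEs tiEs _] := and3P partEs.
have memE X u : X \in Es -> u \in C -> (u \in X) = (X == C).
  move=> EsX Cu; apply/idP/eqP=> [Xu | -> //].
  by rewrite -(def_pblock tiEs EsX Xu) -(def_pblock tiEs EsC Cu).
have sCG : {subset C <= G^#}.
  by move=> u Cu; rewrite -defEs; apply/bigcupP; exists C.
have [I defA] := unionEs A EsA; have [I' defB] := unionEs B EsB.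
apply/eqP; rewrite -(eqr_nat rat); apply/eqP; rewrite defA defB.
rewrite !prod_count_unions ?sCG // !mem_unionsI -defA -defB.
by rewrite !(memE A) // !(memE B).
Qed.

Lemma amorphic_scheme_of_latin :
    (forall k, D k != set0) ->
  amorphic_scheme_on_group G [set D k | k : K] #|K|.
Proof.
move=> ntD; pose Ds := [set D k | k : K].
have injD : injective D.
  by move=> k l eqD; have /set0Pn[g Dg] := ntD k; apply: (tiD Dg); rewrite -eqD.
have partDs : partition Ds G^#.
  apply/and3P; split.
  - by rewrite /cover big_imset ?defG //; apply: in2W.
  - apply/trivIsetP=> _ _ /imsetP[k _ ->] /imsetP[l _ ->] nkl.
    apply/pred0P=> g /=; apply: contraNF nkl => /andP[Dkg Dlg].
    by rewrite (tiD Dkg Dlg).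
  by apply/imsetP=> [[k _ /esym/eqP]]; apply/negP.
have unionDs : {in Ds, forall A, exists I, A = E I}.
  by move=> _ /imsetP[k _ ->]; exists [set k]; rewrite /E big_set1.
split=> // [||P partP]; first exact: scheme_unions.
  rewrite /num_classes (card_group_rels partDs) card_imset //.
have [Es [-> partEs coverEs]] := fusion_group_rels partDs partP.
apply: scheme_unions => // A /coverEs[Bs sBs ->].
exists [set k | D k \in Bs]; apply/setP=> g.
apply/bigcupP/bigcupP=> [[B BsB Bg] | [k Ik Dg]].
  have /imsetP[k _ defB] := subsetP sBs B BsB.
  by exists k; rewrite -?defB // inE -defB.
by exists (D k) => //; rewrite inE in Ik.
Qed.

(** With n = (q + 1) / 2 the coefficients n^2 - 3 n + q and n^2 - n given by
    prod_count_unions are (q^2 - 5) / 4 and (q^2 - 1) / 4. *)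
Lemma regular_pds_half I : (2 * N I = q%:R + 1)%R ->
  regular_pds G (E I) (q ^ 2) ((q ^ 2 - 1) %/ 2) ((q ^ 2 - 5) %/ 4)
    ((q ^ 2 - 1) %/ 4).
Proof.
move=> defN; have sEG := sub_unions I.
have [E'1 sE] : 1 \notin E I /\ E I \subset G.
  split; last by rewrite (subset_trans sEG) ?subD1set.
  by apply/negP=> /(subsetP sEG); rewrite !inE eqxx.
have defN' : (N I = (q%:R + 1) / 2)%R.
  by move: (N I) (q%:R)%R defN => a b defa; lra.
split=> //; last exact: unions_inv.
split=> // [|g Eg nt_g|g /setDP[Gg nEg] nt_g].
- suff: (2 * #|E I| + 1 = q ^ 2)%N by lia.
  apply/eqP; rewrite -(eqr_nat rat) natrD natrM card_unions natrX defN'.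
  by apply/eqP; field.
- rewrite num_quot_prod_count ?unions_inv //; set c := prod_count _ _ _.
  suff: (4 * c + 5 = q ^ 2)%N by lia.
  apply/eqP; rewrite -(eqr_nat rat) natrD natrM prod_count_unions ?(subsetP
    sEG) //.
  by rewrite setIid Eg natrX defN' /= mulr1n; apply/eqP; field.
rewrite num_quot_prod_count ?unions_inv //; set c := prod_count _ _ _.
suff: (4 * c + 1 = q ^ 2)%N by lia.
apply/eqP; rewrite -(eqr_nat rat) natrD natrM prod_count_unions;
  last by apply/setD1P.
by rewrite setIid (negPf nEg) natrX defN' /= mulr0n; apply/eqP; field.
Qed.

End LatinSquareType.

(** * Labels read off from base p digits *)

Section Labels.

Variable p : nat.
Hypothesis p_gt1 : (1 < p)%N.

(** The label d.-1 of the highest nonzero digit d of w among the positions 1 to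
    n, and base when these digits all vanish. The digit at position 0 is left
    to base; read along growing n, this labels the nodes of the tree of
    residues of w modulo p, p^2, ... so that a node passes its label to exactly
    one of its children, and the labels 0 to p - 2 to one child each. *)
Fixpoint top_digit (base w n : nat) : nat :=
  if n is n'.+1 then
    let d := (w %/ p ^ n %% p)%N in
    if d == 0%N then top_digit base w n' else d.-1
  else base.

Let p_gt0 : (0 < p)%N := ltnW p_gt1.
Let pX_gt0 n : (0 < p ^ n)%N. Proof. by rewrite expn_gt0 p_gt0. Qed.

Lemma top_digit_mod base w n :
  top_digit base (w %% p ^ n.+1) n = top_digit base w n.
Proof.
suffices modE m : (n < m)%N ->
    top_digit base (w %% p ^ m) n = top_digit base w n.
  exact: modE.
elim: n => //= n IHn lt_n_m; rewrite {}IHn ?(ltnW lt_n_m) //.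
rewrite divn_modl ?dvdn_exp2l // ?(ltnW lt_n_m) //.
by rewrite modn_dvdm // -expnB ?(ltnW lt_n_m) // dvdn_exp ?subn_gt0.
Qed.

Lemma eq_top_digit base v w n :
  v = w %[mod p ^ n.+1] -> top_digit base v n = top_digit base w n.
Proof. by move=> eq_vw; rewrite -top_digit_mod eq_vw top_digit_mod. Qed.

Lemma top_digit_small base w n : (w < p)%N -> top_digit base w n = base.
Proof.
move=> lt_w_p; elim: n => //= n ->; rewrite divn_small ?mod0n //.
by rewrite (leq_trans lt_w_p) // -{1}[p]expn1 leq_exp2l.
Qed.

Lemma top_digit_lead base d r w n :
    (0 < d < p)%N -> (0 < r <= n)%N -> (w < p ^ r)%N ->
  top_digit base (d * p ^ r + w) n = d.-1.
Proof.
case/andP=> d_gt0 lt_d_p /andP[r_gt0 le_r_n] lt_w.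
elim: n le_r_n => [|n IHn]; first by rewrite leqNgt r_gt0.
rewrite leq_eqVlt => /predU1P[def_r | lt_r_n] /=.
  rewrite -def_r divnMDl // divn_small // addn0 modn_small //.
  by rewrite eqn0Ngt d_gt0.
rewrite IHn // divn_small ?mod0n // (@leq_trans (d.+1 * p ^ r)) //.
  by rewrite mulSn addnC ltn_add2r.
by rewrite (leq_trans (leq_mul lt_d_p (leqnn _))) // -expnS leq_exp2l.
Qed.

Lemma top_digitP base w n :
  top_digit base w n = base /\ (w %% p ^ n.+1 = w %% p)%N \/
  exists d r, [/\ (0 < d < p)%N, (0 < r <= n)%N, top_digit base w n = d.-1
                & (w %% p ^ n.+1 = d * p ^ r + w %% p ^ r)%N].
Proof.
elim: n => [|n IHn]; first by left; rewrite expn1.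
have defw : (w %% p ^ n.+2 =
             (w %/ p ^ n.+1 %% p) * p ^ n.+1 + w %% p ^ n.+1)%N.
  rewrite modn_divl -expnS {1}(divn_eq (w %% p ^ n.+2) (p ^ n.+1)).
  by rewrite modn_dvdm // dvdn_exp2l.
have [d0 | nz_d] := eqVneq (w %/ p ^ n.+1 %% p)%N 0%N; last first.
  right; exists (w %/ p ^ n.+1 %% p)%N, n.+1; rewrite lt0n nz_d ltn_mod p_gt0.
  by rewrite /= leqnn (negPf nz_d).
rewrite /= d0 /=; rewrite {}defw d0 mul0n add0n.
case: IHn => [|[d [r [ltd ler -> ->]]]]; [by left | right].
by exists d, r; split=> //; case/andP: ler => -> /leqW ->.
Qed.

Definition geosum n := \sum_(0 <= l < n) p ^ l.

Lemma geosum0 : geosum 0 = 0%N.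
Proof. by rewrite /geosum big_geq. Qed.

Lemma geosumS n : geosum n.+1 = (geosum n + p ^ n)%N.
Proof. by rewrite /geosum big_nat_recr. Qed.

Lemma sum_digit (F : nat -> nat) n :
  \sum_(0 <= w < p ^ n.+1) F w
  = \sum_(0 <= d < p) \sum_(0 <= w < p ^ n) F (d * p ^ n + w)%N.
Proof.
rewrite expnS big_nat_mul; apply: eq_bigr => d _.
by rewrite mulSn -[X in \sum_(X <= _ < _) _]add0n big_addn addnK;
   apply: eq_bigr => w _; rewrite addnC.
Qed.

(** One more digit multiplies the number of residues by p: the zero digit keeps
    the labels, and every other digit d gives the label d.-1 to all residues.
    So each label below p - 1 gains as many residues as there were before,
    while the other labels gain none. The predicate Q selects the subtree. *)
Lemma count_top_digit (Q : pred nat) (beta : nat -> nat) m e k :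
  \sum_(0 <= w < p ^ (e + m).+1)
     (Q (w %% p ^ m.+1) && (top_digit (beta (w %% p)) w (e + m) == k) : nat)
  = (\sum_(0 <= w < p ^ m.+1) (Q w && (top_digit (beta (w %% p)) w m == k))
     + (k < p.-1) * (\sum_(0 <= w < p ^ m.+1) Q w) * geosum e)%N.
Proof.
have dvd_pX j : p ^ m.+1 %| p ^ (j + m).+1 by rewrite dvdn_exp2l // ltnS
  leq_addl.
have sumQ j : \sum_(0 <= w < p ^ (j + m).+1) (Q (w %% p ^ m.+1) : nat)
    = ((\sum_(0 <= w < p ^ m.+1) Q w) * p ^ j)%N.
  elim: j => [|j IHj].
    by rewrite muln1; apply: eq_big_nat => w /andP[_ ltw]; rewrite modn_small.
  rewrite addSn sum_digit; under eq_bigr => d _.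
    under eq_bigr => w _ do rewrite -(divnK (dvd_pX j)) mulnA modnMDl.
    by rewrite IHj; over.
  by rewrite sum_nat_const_nat subn0 mulnCA -expnS.
elim: e => [|e IHe].
  rewrite geosum0 muln0 addn0.
  by apply: eq_big_nat => w /andP[_ ltw]; rewrite modn_small.
(* The zero digit is split off: it is the one that keeps the labels. *)
rewrite addSn sum_digit big_ltn //.
under eq_big_nat => w /andP[_ ltw].
  rewrite mul0n add0n /= divn_small // mod0n /=; over.
rewrite {}IHe -addnA; congr (_ + _)%N.
rewrite geosumS mulnDr; congr (_ + _)%N.
rewrite -mulnA -sumQ.
transitivity (\sum_(1 <= d < p) \sum_(0 <= w < p ^ (e + m).+1)
    (Q (w %% p ^ m.+1) && (d.-1 == k) : nat)).
  apply: eq_big_nat => d ltd; apply: eq_big_nat => w /andP[_ ltw].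
  rewrite -{1}(divnK (dvd_pX e)) mulnA modnMDl.
  by rewrite top_digit_lead // leqnn.
have [lt_k | le_k] := ltnP k p.-1; rewrite ?mul1n ?mul0n.
  rewrite (bigD1_seq k.+1) /= ?iota_uniq //; last first.
    by rewrite mem_index_iota /= -ltn_predRL.
  rewrite eqxx; under eq_bigr do rewrite andbT.
  rewrite [X in (_ + X)%N]big1_seq ?addn0 // => d /andP[neq_d];
    rewrite mem_index_iota.
  case/andP=> d_gt0 _; rewrite big1 // => w _.
  by rewrite -eqSS prednK // (negPf neq_d) andbF.
rewrite big1_seq // => d /andP[_]; rewrite mem_index_iota => /andP[d_gt0 ltd].
rewrite big1 // => w _; rewrite -eqSS prednK // andbC ltn_eqF //.
by rewrite ltnS (leq_trans _ le_k) // -ltnS prednK.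
Qed.

End Labels.

(** * The order of the presented group *)

Section PresentationOrder.

Variables (p t : nat).
Hypotheses (p_pr : prime p) (t_gt1 : (1 < t)%N).
Let q := (p ^ t)%N.

Lemma gt1_pt : (1 < q)%N.
Proof. by rewrite -(exp1n t) ltn_exp2r ?prime_gt1 ?(ltnW t_gt1). Qed.

(** The square of (p - 1) p^(t - 1) vanishes modulo p^t, since t > 1. *)
Lemma twist_expn k :
  twist p t ^ k = 1 + k * ((p - 1) * p ^ (t - 1)) %[mod q].
Proof.
elim: k => [|k IHk]; first by rewrite mul0n.
rewrite expnS -modnMmr IHk modnMmr /twist; set m := ((p - 1) * _)%N.
have -> : ((m + 1) * (1 + k * m) = k * m * m + (1 + k.+1 * m))%N by ring.
have /dvdnP[c ->] : q %| k * m * m; last by rewrite modnMDl.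
rewrite -mulnA dvdn_mull // /m mulnACA dvdn_mull // -expnD dvdn_exp2l //.
by move: t_gt1; lia.
Qed.

Lemma coprime_twist : coprime q (twist p t).
Proof.
rewrite /q coprime_pexpl ?(ltnW t_gt1) //.
rewrite prime_coprime // /twist dvdn_addr ?dvdn1 ?gtn_eqF ?prime_gt1 //.
by rewrite dvdn_mull // -[in X in X %| _](expn1 p) dvdn_exp2l // subn_gt0.
Qed.

(** A presentation bounds the order from above; the lower bound comes from a
    model of the relations, the semidirect product of two cyclic groups of
    order q, which is then a homomorphic image of G. *)
Lemma leq_card_presented gT (G : {group gT}) :
  G \isog Grp (a : b : a ^+ q, b ^+ q, b * a * b^-1 = a ^+ twist p t) ->
  (q * q <= #|G|)%N.
Proof.
move=> isoG; pose b : 'Z_q := Zp1.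
pose H := [set: Extremal.gtype q q (twist p t)].
have ob : #[b] = q by rewrite order_Zp1 Zp_cast ?gt1_pt.
have isoH : H \isog Grp (x : y : x ^+ q, y ^+ q, x ^ y = x ^+ twist p t).
  apply: Extremal.Grp; rewrite ?gt1_pt // -/b.
  have Uu : ((twist p t)%:R : 'Z_#[b])%R \is a GRing.unit.
    by rewrite unitZpE ob ?gt1_pt // coprime_twist.
  pose u := FinRing.unit ('Z_#[b]) Uu; exists (Zp_unitm u).
  rewrite Aut_aut order_injm ?injm_Zp_unitm ?in_setT //; split=> //.
    rewrite order_dvdn -val_eqE /= FinRing.val_unitX /= -natrX.
    rewrite -(Zp_nat_mod (_ : 1 < #[b])) ob ?gt1_pt //.
    by rewrite twist_expn addnC [(q * _)%N]mulnC modnMDl modn_small ?gt1_pt.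
  apply/eqP; rewrite autE ?cycle_id // eq_expg_mod_order /=.
  by rewrite val_Zp_nat ob ?gt1_pt // modn_mod.
have [[X Y] /= /eqP[defH Xq Yq XY]] := existsP (isoGrp_hom isoH).
have homH : H \homg G.
  (* In the model X is conjugated by Y on the right, whence the inverse. *)
  rewrite isoG; apply/existsP; exists (X, Y^-1) => /=.
  rewrite !xpair_eqE cycleV defH Xq expgVn Yq invg1 invgK !eqxx /=.
  by rewrite -mulgA -conjgE XY.
rewrite -(Extremal.card (twist p t) gt1_pt gt1_pt).
exact: leq_homg homH.
Qed.

Lemma sdprod_of_presented gT (G : {group gT}) x y :
  Ghat_spec p t G x y -> Ghat_sdprod p t G x y.
Proof.
case=> /leq_card_presented leG [defG xq yq xy].
have nXY : <[y]> \subset 'N(<[x]>).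
  by rewrite -cycleV norms_cycle conjgE invgK mulgA xy mem_cycle.
have eqXY : <[x]> * <[y]> = G by rewrite -norm_joinEr.
have le_x : (#[x] <= q)%N.
  by rewrite dvdn_leq ?(ltnW gt1_pt) // order_dvdn xq.
have le_y : (#[y] <= q)%N.
  by rewrite dvdn_leq ?(ltnW gt1_pt) // order_dvdn yq.
have q_gt0 := ltnW gt1_pt.
have := mul_cardG <[x]> <[y]>; rewrite eqXY -!orderE => eq_card.
have le_xy := leq_mul le_x le_y.
have tiXY : #|<[x]> :&: <[y]>| = 1%N.
  apply/eqP; rewrite eqn_leq cardG_gt0 andbT -(@leq_pmul2l #|G|) ?cardG_gt0 //.
  by rewrite -eq_card muln1 (leq_trans le_xy).
move: eq_card; rewrite tiXY muln1 => eq_card; split=> //.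
- by rewrite sdprodE //; apply/eqP; rewrite trivg_card1 tiXY.
- apply/eqP; rewrite eqn_leq le_x -(leq_pmul2r q_gt0).
  by rewrite (leq_trans leG) // -eq_card leq_mul.
apply/eqP; rewrite eqn_leq le_y -(leq_pmul2l q_gt0).
by rewrite (leq_trans leG) // -eq_card leq_mul.
Qed.

End PresentationOrder.

(** * Power subgroups and maximal cyclic subgroups *)

Section PowerStructure.

Variables (p t : nat) (gT : finGroupType) (G : {group gT}) (x y : gT).
Hypotheses (p_pr : prime p) (p_odd : odd p) (t_gt1 : (1 < t)%N).
Hypothesis sdG : Ghat_sdprod p t G x y.
Let q := (p ^ t)%N.
Let p_gt0 : (0 < p)%N := prime_gt0 p_pr.
Let p_gt1 : (1 < p)%N := prime_gt1 p_pr.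

Lemma order_x : #[x] = q. Proof. by case: sdG. Qed.
Lemma order_y : #[y] = q. Proof. by case: sdG. Qed.

Lemma XY_G : <[x]> * <[y]> = G.
Proof. by case: sdG => /sdprodP[]. Qed.

Lemma tiXY : <[x]> :&: <[y]> = 1.
Proof. by case: sdG => /sdprodP[]. Qed.

Lemma Gx : x \in G.
Proof. by rewrite -cycle_subG -XY_G mulG_subl. Qed.

Lemma Gy : y \in G.
Proof. by rewrite -cycle_subG -XY_G mulG_subr. Qed.

Lemma G_xy g : g \in G -> exists a b, g = x ^+ a * y ^+ b.
Proof.
by rewrite -XY_G => /mulsgP[_ _ /cycleP[a ->] /cycleP[b ->] ->]; exists a, b.
Qed.

Lemma card_G : #|G| = (q ^ 2)%N.
Proof. by rewrite -XY_G TI_cardMg ?tiXY // -!orderE order_x order_y mulnn. Qed.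

Lemma xy_eq1 a b : x ^+ a * y ^+ b = 1 -> x ^+ a = 1 /\ y ^+ b = 1.
Proof.
move=> xy1; have ya : y ^+ b = 1.
  apply/set1gP; rewrite -tiXY inE mem_cycle andbT.
  by rewrite -[y ^+ b]mul1g -(mulVg (x ^+ a)) -mulgA xy1 mulg1 groupV mem_cycle.
by move: xy1; rewrite ya mulg1.
Qed.

Let c := x ^+ ((p - 1) * p ^ (t - 1)).

Lemma conj_xV : x ^ y^-1 = x ^+ twist p t.
Proof. by have [_ _ _ <-] := sdG; rewrite conjgE invgK mulgA. Qed.

Lemma commxV : [~ x, y^-1] = c.
Proof.
by rewrite commgEl conj_xV /twist addn1 expgS mulKg.
Qed.

(** The group has class 2: the commutator of the two generators is a power of
    x^(p^(t - 1)), on which y acts trivially. *)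
Lemma c_central : c \in 'C(G).
Proof.
have cx : commute x c by apply: commuteX.
have cy : commute y c.
  apply/commute_sym; rewrite -[y]invgK; apply/commuteV/commgP/conjg_fixP.
  rewrite conjXg conj_xV -expgM.
  apply/eqP; rewrite eq_expg_mod_order order_x /twist mulnDl mul1n.
  set k := ((p - 1) * _)%N; have /dvdnP[d ->] : q %| k * k.
    rewrite /k mulnACA dvdn_mull // -expnD dvdn_exp2l //.
    by move: t_gt1; lia.
  by rewrite modnMDl.
apply/centP=> _ /G_xy[a [b ->]].
by apply: commuteM; apply: commuteX; apply: commute_sym.
Qed.

Lemma c_exp_p : c ^+ p = 1.
Proof.
have tE : (t - 1).+1 = t by move: t_gt1; lia.
rewrite -expgM -mulnA -expnSr tE mulnC expgM.
by rewrite -/q -order_x expg_order expg1n.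
Qed.

Lemma comm_G g h : g \in G -> h \in G -> [~ g, h] \in <[c]>.
Proof.
have defG : <[x]> <*> <[y^-1]> = G.
  have nXY : <[y]> \subset 'N(<[x]>) by case: sdG => /sdprodP[].
  by rewrite cycleV norm_joinEr ?XY_G.
have derG : G^`(1) = <[c]>.
  have := @der1_joing_cycles _ x y^-1; rewrite defG commxV /=.
  by apply; apply: c_central.
by move=> Gg Gh; rewrite -derG derg1 mem_commg.
Qed.

Lemma comm_central g h u :
  g \in G -> h \in G -> u \in G -> commute u [~ g, h].
Proof.
move=> Gg Gh Gu; have /cycleP[i ->] := comm_G Gg Gh.
by apply: commuteX; apply/commute_sym; apply: (centP c_central).
Qed.

Lemma comm_exp_p g h : g \in G -> h \in G -> [~ g, h] ^+ p = 1.
Proof.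
move=> Gg Gh; have /cycleP[i ->] := comm_G Gg Gh.
by rewrite -expgM mulnC expgM c_exp_p expg1n.
Qed.

(** The correction term of the class 2 power formula is a commutator to the
    power 'C(p^k, 2), and p divides this binomial because p is odd. *)
Lemma expgM_pX k g h : (0 < k)%N -> g \in G -> h \in G ->
  (g * h) ^+ (p ^ k) = g ^+ (p ^ k) * h ^+ (p ^ k).
Proof.
move=> k_gt0 Gg Gh; rewrite expMg_Rmul; try exact: comm_central.
have /dvdnP[m ->] : p %| 'C(p ^ k, 2).
  by rewrite bin2odd ?oddX ?p_odd ?orbT // dvdn_mulr // dvdn_exp.
by rewrite mulnC expgM comm_exp_p // expg1n mulg1.
Qed.

(** The elements of order at most p^m; they form a subgroup since p-power maps
    are endomorphisms. *)
Definition Om m : {set gT} := [set g in G | g ^+ (p ^ m) == 1].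

Lemma mem_Om m g : g \in G -> (g \in Om m) = (g ^+ (p ^ m) == 1).
Proof. by move=> Gg; rewrite inE Gg. Qed.

Lemma Om_group_set m : group_set (Om m).
Proof.
apply/group_setP; split=> [|g h]; first by rewrite inE group1 expg1n eqxx.
rewrite !inE => /andP[Gg /eqP g1] /andP[Gh /eqP h1]; rewrite groupM //.
case: m g1 h1 => [|m] g1 h1.
  by move: g1 h1; rewrite expn0 !expg1 => -> ->; rewrite mulg1 eqxx.
by rewrite expgM_pX // g1 h1 mulg1 eqxx.
Qed.
Canonical Om_group m := Group (Om_group_set m).

Lemma Om_sub m : Om m \subset G.
Proof. by apply/subsetP=> g; rewrite inE => /andP[]. Qed.

Lemma Om_norm m : G \subset 'N(Om m).
Proof.
apply/subsetP=> h Gh; rewrite inE; apply/subsetP=> u /imsetP[g].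
by rewrite !inE => /andP[Gg /eqP g1] ->;
  rewrite groupJ // -conjXg g1 conj1g eqxx.
Qed.

Lemma Om_S m n : (m <= n)%N -> Om m \subset Om n.
Proof.
move=> le_mn; apply/subsetP=> g; rewrite !inE => /andP[-> /eqP g1] /=.
by rewrite -(subnKC le_mn) expnD expgM g1 expg1n.
Qed.

Lemma exp_eq1 (u : gT) a m : #[u] = q -> (m <= t)%N ->
  (u ^+ a ^+ (p ^ m) == 1) = (p ^ (t - m) %| a).
Proof.
move=> ou le_mt; rewrite -expgM -order_dvdn ou /q -{1}(subnK le_mt) expnD.
by rewrite dvdn_pmul2r ?expn_gt0 ?p_gt0.
Qed.

Lemma Om_XY m : (m <= t)%N ->
  Om m = <[x ^+ (p ^ (t - m))]> * <[y ^+ (p ^ (t - m))]>.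
Proof.
move=> le_mt; apply/eqP; rewrite eqEsubset; apply/andP; split; last first.
  rewrite mul_subG // cycle_subG mem_Om ?groupX ?Gx ?Gy //.
    by rewrite exp_eq1 ?order_x.
  by rewrite exp_eq1 ?order_y.
apply/subsetP=> g; rewrite inE => /andP[/G_xy[a [b ->]]] /eqP g1.
have dvdX (u : gT) d : p ^ (t - m) %| d -> u ^+ d \in <[u ^+ (p ^ (t - m))]>.
  by case/dvdnP=> e ->; rewrite mulnC expgM mem_cycle.
have [xa yb] : x ^+ a ^+ (p ^ m) = 1 /\ y ^+ b ^+ (p ^ m) = 1.
  case: m le_mt g1 {dvdX} => [|m] le_mt g1.
    by rewrite !expg1; apply: xy_eq1; rewrite -[LHS]expg1.
  rewrite -!expgM; apply: xy_eq1; rewrite !expgM -expgM_pX ?groupX ?Gx ?Gy //.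
apply: mem_mulg; apply: dvdX; first by rewrite -(exp_eq1 _ order_x le_mt) xa.
by rewrite -(exp_eq1 _ order_y le_mt) yb.
Qed.

Lemma card_Om m : (m <= t)%N -> #|Om m| = (p ^ (2 * m))%N.
Proof.
move=> le_mt; rewrite Om_XY // TI_cardMg; last first.
  apply/trivgP; rewrite -tiXY setISS ?cycleX //.
have oX (u : gT) : #[u] = q -> #[u ^+ (p ^ (t - m))] = (p ^ m)%N.
  move=> ou; rewrite orderXdiv ou ?dvdn_exp2l ?leq_subr // -expnB ?leq_subr //.
  by rewrite subKn.
by rewrite -!orderE !oX ?order_x ?order_y // -expnD addnn mul2n.
Qed.

Lemma Om0 : Om 0 = 1.
Proof. by apply/eqP; rewrite trivg_card1 /= card_Om. Qed.

Lemma Om_t : Om t = G.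
Proof.
apply/eqP; rewrite eqEcard Om_sub card_Om // card_G -expnM mulnC leqnn.
by [].
Qed.

(** Generators of the maximal cyclic subgroups, which correspond to the points
    of the projective line over Z/p^t: b = false stands for the affine point
    (1:w), and b = true, used with p dividing w, for the point (w:1) at
    infinity modulo p. *)
Definition gen (b : bool) (w : nat) : gT :=
  if b then x ^+ w * y else x * y ^+ w.

Definition valid (b : bool) (w : nat) := b ==> (p %| w).

Lemma gen_G b w : gen b w \in G.
Proof. by case: b; rewrite /gen groupM ?groupX ?Gx ?Gy. Qed.

Lemma gen_exp b w k :
  gen b w ^+ (p ^ k) = if b then x ^+ (w * p ^ k) * y ^+ (p ^ k)
                       else x ^+ (p ^ k) * y ^+ (w * p ^ k).
Proof.
case: k => [|k]; first by rewrite !muln1 !expg1.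
by rewrite /gen; case: b; rewrite expgM_pX ?groupX ?Gx ?Gy // expgM.
Qed.

Lemma order_gen b w : #[gen b w] = q.
Proof.
have: #[gen b w] %| q.
  by rewrite order_dvdn -mem_Om ?gen_G // Om_t gen_G.
case/(dvdn_pfactor _ _ p_pr) => k; rewrite leq_eqVlt => /predU1P[-> // | lt_kt].
move=> ou; have: gen b w ^+ (p ^ t.-1) = 1.
  apply/eqP; rewrite -order_dvdn ou dvdn_exp2l //.
  by rewrite -ltnS prednK ?(ltnW t_gt1).
have nt_exp (u : gT) : #[u] = q -> u ^+ (p ^ t.-1) <> 1.
  move=> oq /eqP; rewrite -order_dvdn oq; apply/negP;
    rewrite gtnNdvd ?expn_gt0 ?p_gt0 //.
  by rewrite ltn_exp2l // prednK ?(ltnW t_gt1).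
rewrite gen_exp; case: b {ou} => /xy_eq1[].
  by move=> _ /(nt_exp y order_y).
by move=> /(nt_exp x order_x).
Qed.

(** Maximal cyclic subgroups are the leaves of a tree whose nodes at level m
    are the cyclic subgroups of order p^m. *)
Definition leaf b w := <[gen b w]>.

Lemma leaf_sub b w : leaf b w \subset G.
Proof. by rewrite cycle_subG gen_G. Qed.

Lemma card_leaf b w : #|leaf b w| = q. Proof. exact: order_gen. Qed.

Lemma sub_cycle (u : gT) (H : {group gT}) l : #[u] = q -> (l <= t)%N ->
  H \subset <[u]> -> #|H| = (p ^ l)%N -> H :=: <[u ^+ (p ^ (t - l))]>.
Proof.
move=> ou le_lt sHu oH; apply/eqP.
rewrite (eq_subG_cyclic (cycle_cyclic u)) ?cycleX // oH -orderE.
by rewrite orderXdiv ou ?dvdn_exp2l ?leq_subr // -expnB ?leq_subr // subKn.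
Qed.

Lemma leaf_Om b w m : (m <= t)%N ->
  leaf b w :&: Om m = <[gen b w ^+ (p ^ (t - m))]>.
Proof.
move=> le_mt; apply/eqP; rewrite eq_sym eqEcard subsetI cycleX /=.
rewrite cycle_subG mem_Om ?groupX ?gen_G // exp_eq1 ?order_gen // dvdnn /=.
have /cyclicP[v defv] : cyclic (leaf b w :&: Om m).
  exact: cyclicS (subsetIl _ _) (cycle_cyclic _).
have : v \in leaf b w :&: Om m by rewrite defv cycle_id.
case/setIP=> _; rewrite inE => /andP[_]; rewrite -order_dvdn => dvd_v.
rewrite defv -!orderE orderXdiv order_gen ?dvdn_exp2l ?leq_subr //.
by rewrite -expnB ?leq_subr // subKn // dvdn_leq ?expn_gt0 ?p_gt0.
Qed.

Lemma card_leaf_Om b w m : (m <= t)%N -> #|leaf b w :&: Om m| = (p ^ m)%N.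
Proof.
move=> le_mt; rewrite leaf_Om // -orderE orderXdiv order_gen.
  by rewrite -expnB ?leq_subr // subKn.
by rewrite dvdn_exp2l ?leq_subr.
Qed.

Lemma card_sub_leaf b w (H : {group gT}) :
  H \subset leaf b w -> exists2 l, (l <= t)%N & #|H| = (p ^ l)%N.
Proof.
by move=> sHC; apply/(dvdn_pfactor _ _ p_pr);
  rewrite -/q -(order_gen b w) cardSg.
Qed.

(** If the intersection were nontrivial, both subgroups would share their
    subgroup of order p. For the second one it lies in <[y]>, as p divides w';
    for the first one it is generated by an element whose x-component is not
    trivial. *)
Lemma ti_leaves w w' : (p %| w')%N -> leaf false w :&: leaf true w' = 1.
Proof.
move=> dvd_w'; have [l le_lt oH] := card_sub_leaf (subsetIl (leaf false w)
  (leaf true w')).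
case: l => [|l] in le_lt oH *; first by apply/eqP; rewrite trivg_card1 oH.
have defu := sub_cycle (order_gen _ _) le_lt (subsetIl _ _) oH.
have defv := sub_cycle (order_gen _ _) le_lt (subsetIr _ _) oH.
have tE : (t - l.+1 + l = t.-1)%N by move: le_lt; lia.
have powN (u : gT) : u ^+ (p ^ t.-1) = u ^+ (p ^ (t - l.+1)) ^+ (p ^ l).
  by rewrite -expgM -expnD tE.
have oX b k : #[gen b k ^+ (p ^ t.-1)] = p.
  rewrite orderXdiv order_gen ?dvdn_exp2l ?leq_pred // -expnB ?leq_pred //.
  by rewrite (_ : t - t.-1 = 1)%N //; move: t_gt1; lia.
have Hu : gen false w ^+ (p ^ t.-1) \in leaf true w'.
  have: gen false w ^+ (p ^ t.-1) \in leaf false w :&: leaf true w'.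
    by rewrite defu powN mem_cycle.
  by case/setIP.
have : <[gen false w ^+ (p ^ t.-1)]> == <[gen true w' ^+ (p ^ t.-1)]>.
  rewrite (eq_subG_cyclic (cycle_cyclic (gen true w'))) ?cycleX ?cycle_subG //.
  by rewrite -!orderE !oX.
move/eqP/setP/(_ (gen false w ^+ (p ^ t.-1))); rewrite cycle_id => /esym.
have /eqP : #[gen false 0 ^+ (p ^ t.-1)] = p by apply: oX.
rewrite !gen_exp mul0n expg0 mulg1.
have -> : x ^+ (w' * p ^ t.-1) = 1.
  case/dvdnP: dvd_w' => d ->; rewrite -mulnA -expnS prednK ?(ltnW t_gt1) //.
  by rewrite mulnC expgM -/q -order_x expg_order expg1n.
rewrite mul1g => oxN /cycleP[d]; rewrite -expgM => defd.
have : x ^+ (p ^ t.-1) \in <[x]> :&: <[y]>.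
  rewrite inE mem_cycle -(mulgK (y ^+ (w * p ^ t.-1)) (x ^+ _)) defd.
  by rewrite groupM ?groupV ?mem_cycle.
rewrite tiXY => /set1gP x1; move: oxN; rewrite x1 order1 => /eqP p1.
by move: p_gt1; rewrite -p1.
Qed.

(** The two leaves lie over the same node of level s of the tree. *)
Definition agree (s : nat) (b : bool) (w : nat) (b' : bool) (w' : nat) :=
  (s == 0%N) || ((b == b') && (w == w' %[mod p ^ s])).

Lemma agree_sub s b w b' w' : (s <= t)%N -> agree s b w b' w' ->
  leaf b' w' \subset leaf b w * Om (t - s).
Proof.
move=> le_st; have nOm := Om_norm (t - s).
have eC : commute (leaf b w) (Om (t - s)).
  by apply: normC; apply: subset_trans (leaf_sub b w) nOm.
case/predU1P=> [-> | /andP[/eqP <- /eqP eqw]].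
  by rewrite subn0 Om_t mulSGid ?leaf_sub.
have memOm (u : gT) : u \in G -> #[u] = q ->
    (u ^+ w)^-1 * u ^+ w' \in Om (t - s).
  move=> Gu ou; rewrite mem_Om ?groupM ?groupV ?groupX // expgMn; last first.
    by apply/commute_sym/commuteV/commuteX2.
  rewrite expgVn -eq_mulVg1 -!expgM eq_expg_mod_order ou /q.
  have -> : (p ^ t = p ^ s * p ^ (t - s))%N by rewrite -expnD subnKC.
  by rewrite -!muln_modl eqw.
rewrite -norm_joinEl ?(subset_trans (leaf_sub b w)) // {1}/leaf cycle_subG.
have memC u v : u \in leaf b w -> v \in Om (t - s) ->
    u * v \in leaf b w <*> Om (t - s).
  by move=> Cu Ov; rewrite groupM // mem_gen // inE ?Cu ?Ov ?orbT.
have nOmJ u v : u \in Om (t - s) -> v \in G -> u ^ v \in Om (t - s).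
  by move=> Ou Gv; rewrite memJ_norm // (subsetP nOm).
case: b {eC} memC => memC; last first.
  rewrite /gen -(mulKVg (y ^+ w) (y ^+ w')) mulgA.
  by rewrite memC ?cycle_id ?memOm ?Gy ?order_y.
rewrite -(mulKVg (gen true w) (gen true w')) memC ?cycle_id //.
have -> : (gen true w)^-1 * gen true w' = ((x ^+ w)^-1 * x ^+ w') ^ y.
  by rewrite /gen invMg conjgE !mulgA.
by rewrite nOmJ ?memOm ?Gy ?Gx ?order_x.
Qed.

Lemma ti_leaf_neq b w b' w' : valid b w -> valid b' w' -> b != b' ->
  leaf b w :&: leaf b' w' = 1.
Proof.
by case: b; case: b' => //= vw vw' _; [rewrite setIC|]; apply: ti_leaves.
Qed.

(** If the leaves agree at level m then the second one lies in the product of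
    the first one with Om (t - m), and a count of elements gives m <= s.
    Conversely a common subgroup of order p^s contains the p^(t - s)-th powers
    of both generators, hence their quotient, a power of x or y lying in a leaf
    that meets <[x]> or <[y]> trivially. *)
Lemma agree_leq s m b w b' w' : valid b w -> valid b' w' -> (m <= t)%N ->
    #|leaf b w :&: leaf b' w'| = (p ^ s)%N ->
  agree m b w b' w' = (m <= s)%N.
Proof.
move=> vw vw' le_mt oI; apply/idP/idP=> [agr | le_ms].
  have := subset_leq_card (mulgSS (subxx (leaf b w)) (agree_sub le_mt agr)).
  rewrite mulgA mulGid => le_card.
  have := mul_cardG (leaf b w) (leaf b' w');
    have := mul_cardG (leaf b w) (Om (t - m)).
  rewrite !card_leaf card_leaf_Om ?leq_subr // card_Om ?leq_subr // oI => e1 e2.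
  have: (q * q * p ^ (t - m) <= q * p ^ (2 * (t - m)) * p ^ s)%N.
    by rewrite e2 e1 mulnAC !leq_mul.
  rewrite /q -!expnD leq_exp2l //; move: le_mt; lia.
have [defb | neqb] := eqVneq b b'; last first.
  move: oI; rewrite ti_leaf_neq // cards1; case: s le_ms => [|s] le_ms.
    by move: le_ms; rewrite leqn0 /agree => ->.
  by move/esym/eqP; rewrite expnS muln_eq1 (gtn_eqF p_gt1).
have [l le_lt oI'] := card_sub_leaf (subsetIl (leaf b w) (leaf b' w')).
have eq_ls : l = s by apply/eqP; rewrite -(eqn_exp2l _ _ p_gt1) -oI -oI'.
rewrite /agree -{}defb in oI oI' *; rewrite eq_ls in le_lt; rewrite eqxx /=.
apply/orP; right; rewrite -(modn_dvdm w (dvdn_exp2l p le_ms)).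
rewrite -(modn_dvdm w' (dvdn_exp2l p le_ms));
  suffices -> : w = w' %[mod p ^ s] by [].
have defu := sub_cycle (order_gen _ _) le_lt (subsetIl _ _) oI.
have defv := sub_cycle (order_gen _ _) le_lt (subsetIr _ _) oI.
have Cu : gen b w ^+ (p ^ (t - s)) \in leaf b w by rewrite mem_cycle.
have Cv : gen b w' ^+ (p ^ (t - s)) \in leaf b w.
  have: gen b w' ^+ (p ^ (t - s)) \in leaf b w :&: leaf b w' by rewrite defv
    cycle_id.
  by case/setIP.
have eq_exp (u : gT) : #[u] = q ->
    u ^+ (w * p ^ (t - s)) = u ^+ (w' * p ^ (t - s)) -> w = w' %[mod p ^ s].
  move=> ou /eqP; rewrite eq_expg_mod_order ou /q.
  have -> : (p ^ t = p ^ s * p ^ (t - s))%N by rewrite -expnD subnKC.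
  by rewrite -!muln_modl eqn_pmul2r ?expn_gt0 ?p_gt0 // => /eqP.
rewrite !gen_exp in Cu Cv;
  case: b {oI oI' defu defv} vw vw' Cu Cv => vw vw' Cu Cv.
  apply: (eq_exp x order_x); apply/eqP; rewrite eq_mulgV1; apply/eqP/set1gP.
  rewrite -(ti_leaves 0 vw) inE {1}/leaf /gen expg0 mulg1.
  rewrite groupM ?groupV ?mem_cycle //=.
  by have := groupM Cu (groupVr Cv); rewrite invMg mulgA mulgK.
apply: (eq_exp y order_y); apply/eqP; rewrite eq_mulVg1; apply/eqP/set1gP.
rewrite -(ti_leaves w (dvdn0 p)) inE {2}/leaf /gen expg0 mul1g.
rewrite [X in _ && X]groupM ?groupV ?mem_cycle // andbT.
by have := groupM (groupVr Cu) Cv; rewrite invMg -mulgA mulKg.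
Qed.

(** The right-hand side contains the left-hand one by agree_sub, and both have
    p^(2t - s) elements. *)
Lemma mul_leaf s b w b' w' : valid b w -> valid b' w' ->
    #|leaf b w :&: leaf b' w'| = (p ^ s)%N ->
  leaf b w * leaf b' w' = leaf b w * Om (t - s).
Proof.
move=> vw vw' oI; have le_st : (s <= t)%N.
  rewrite -(leq_exp2l _ _ p_gt1) -oI -/q -(card_leaf b w).
  exact: subset_leq_card (subsetIl _ _).
apply/eqP; rewrite eqEcard; apply/andP; split.
  have agr : agree s b w b' w' by rewrite (agree_leq vw vw' le_st oI).
  have := mulgSS (subxx (leaf b w)) (agree_sub le_st agr).
  by rewrite mulgA mulGid.
have := mul_cardG (leaf b w) (leaf b' w');
  have := mul_cardG (leaf b w) (Om (t - s)).
rewrite !card_leaf card_leaf_Om ?leq_subr // card_Om ?leq_subr // oI => e1 e2.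
rewrite -(@leq_pmul2r (p ^ s * p ^ (t - s))) ?muln_gt0 ?expn_gt0 ?p_gt0 //.
rewrite [X in (_ <= X)%N]mulnA -e2 mulnCA mulnC -e1 /q -!expnD leq_exp2l //.
by move: le_st; lia.
Qed.

(** A nontrivial subgroup of a cyclic p-group contains its subgroup of order p.
    *)
Lemma socle_mem (u : gT) (K : {group gT}) : #[u] = q ->
  K \subset <[u]> -> K :!=: 1 -> u ^+ (p ^ t.-1) \in K.
Proof.
move=> ou sKu ntK; have : #|K| %| p ^ t by rewrite -/q -ou cardSg.
case/(dvdn_pfactor _ _ p_pr) => -[|l] le_lt oK.
  by case/eqP: ntK; apply/eqP; rewrite trivg_card1 oK.
rewrite (sub_cycle ou le_lt sKu oK); apply/cycleP; exists (p ^ l)%N;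
  rewrite -expgM -expnD.
by congr (_ ^+ (_ ^ _)); move: le_lt; lia.
Qed.

Lemma mem_leaf_gen (g : gT) b w :
  #[g] = q -> gen b w \in <[g]> -> g \in leaf b w.
Proof.
move=> og; rewrite -cycle_subG => sCg;
  rewrite /leaf (_ : <[gen b w]> = <[g]>) ?cycle_id //.
by apply/eqP; rewrite eqEcard sCg -!orderE og order_gen /=.
Qed.

(** A cyclic subgroup of order q cannot meet both <[x]> and <[y]> nontrivially.
    If it misses <[y]> it is a complement, so it contains some x y^w; if it
    meets <[y]> it is a complement of <[x]> and contains some x^w y, where p
    divides w because x^w y has a nontrivial power in <[y]>. *)
Lemma max_leaf_cover g : g \in G -> #[g] = q ->
  exists b w, [/\ valid b w, (w < q)%N & g \in leaf b w].
Proof.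
move=> Gg og; have sgG : <[g]> \subset G by rewrite cycle_subG.
have mulG_full (u : gT) : u \in G -> #[u] = q -> <[g]> :&: <[u]> = 1 ->
    <[g]> * <[u]> = G /\ <[u]> * <[g]> = G.
  move=> Gu ou ti; split; apply/eqP; rewrite eqEcard mul_subG ?cycle_subG //.
    by rewrite TI_cardMg // -!orderE og ou card_G mulnn leqnn.
  by rewrite TI_cardMg 1?setIC // -!orderE og ou card_G mulnn leqnn.
have [ti_gy | nt_gy] := eqVneq (<[g]> :&: <[y]>) 1.
  have [gyG _] := mulG_full y Gy order_y ti_gy.
  have: x \in <[g]> * <[y]> by rewrite gyG Gx.
  case/mulsgP=> h v Ch /groupVr/cyclePmin[w lt_w defv] defx.
  exists false, w; rewrite -order_y; split=> //; apply: mem_leaf_gen => //.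
  by rewrite /gen -defv defx mulgK.
have [ti_gx | nt_gx] := eqVneq (<[g]> :&: <[x]>) 1; last first.
  have gNx := socle_mem og (subsetIl <[g]> <[x]>) nt_gx.
  have gNy := socle_mem og (subsetIl <[g]> <[y]>) nt_gy.
  have: g ^+ (p ^ t.-1) \in <[x]> :&: <[y]>.
    by case/setIP: gNx => _ ?; case/setIP: gNy => _ ?; apply/setIP.
  rewrite tiXY => /set1gP/eqP; rewrite -order_dvdn og /q.
  by rewrite dvdn_Pexp2l // leqNgt prednK ?leqnn // (ltnW t_gt1).
have [_ xgG] := mulG_full x Gx order_x ti_gx.
have: y \in <[x]> * <[g]> by rewrite xgG Gy.
case/mulsgP=> v h /groupVr/cyclePmin[w lt_w defv] Ch defy.
have defh : h = gen true w by rewrite /gen -defv defy mulKg.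
exists true, w; rewrite -order_x; split=> //; last first.
  by apply: mem_leaf_gen; rewrite -?defh.
have eqgh : <[g]> = <[gen true w]>.
  by apply/eqP; rewrite eq_sym eqEcard cycle_subG -defh Ch -!orderE og defh
    order_gen /=.
rewrite eqgh in nt_gy.
have := socle_mem (order_gen true w) (subsetIl _ <[y]>) nt_gy.
case/setIP=> _; rewrite gen_exp => hN.
have : x ^+ (w * p ^ t.-1) \in <[x]> :&: <[y]>.
  rewrite inE mem_cycle -(mulgK (y ^+ (p ^ t.-1)) (x ^+ _)).
  by rewrite groupM ?groupV ?mem_cycle.
rewrite tiXY => /set1gP/eqP; rewrite -order_dvdn order_x /q.
rewrite -{1}(prednK (ltnW t_gt1)) expnS dvdn_pmul2r // expn_gt0 p_gt0 //.
Qed.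

(** An element of order less than q is a p-th power, so the claim is reduced to
    elements of larger and larger order. *)
Lemma leaf_cover g :
  g \in G -> exists b w, [/\ valid b w, (w < q)%N & g \in leaf b w].
Proof.
move=> Gg; have [-> | nt_g] := eqVneq g 1.
  by exists false, 0%N; rewrite group1 /q expn_gt0 p_gt0.
have nOg : g \notin Om (t.-1 - t.-1) by rewrite subnn Om0 inE.
suffices cov k h : (k <= t.-1)%N -> h \in G -> h \notin Om (t.-1 - k) ->
    exists b w, [/\ valid b w, (w < q)%N & h \in leaf b w].
  exact: (cov t.-1 g).
elim: k h {g Gg nt_g nOg} => [|k IHk] h le_kt Gh.
  rewrite subn0 => nOh; apply: max_leaf_cover => //.
  have: #[h] %| q by rewrite order_dvdn -mem_Om // Om_t.
  case/(dvdn_pfactor _ _ p_pr)=> l le_lt oh; rewrite oh /q.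
  suffices -> : l = t by [].
  apply/eqP; rewrite eqn_leq le_lt leqNgt; apply: contra nOh => lt_lt.
  rewrite mem_Om // -order_dvdn oh dvdn_exp2l // -ltnS prednK //.
  exact: ltnW t_gt1.
move=> nOh; have [Oh | nOh'] := boolP (h \in Om (t.-1 - k)); last first.
  by apply: IHk => //; apply: ltnW.
have : h \in Om t.-1 by apply: subsetP Oh; rewrite Om_S ?leq_subr.
rewrite Om_XY ?leq_pred // (_ : t - t.-1 = 1)%N; last by move: t_gt1; lia.
case/mulsgP=> _ _ /cycleP[i ->] /cycleP[j ->] defh.
have {}defh : h = (x ^+ i * y ^+ j) ^+ (p ^ 1).
  by rewrite expgM_pX ?groupX ?Gx ?Gy // defh -!expgM ![(p ^ 1 * _)%N]mulnC.
have Gh1 : x ^+ i * y ^+ j \in G by rewrite groupM ?groupX ?Gx ?Gy.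
have [|b [w [vw ltw Ch]]] := IHk _ (ltnW le_kt) Gh1.
  apply: contra nOh; rewrite !mem_Om // defh -expgM -expnD.
  by rewrite (_ : 1 + (t.-1 - k.+1) = t.-1 - k)%N //; move: le_kt; lia.
by exists b, w; rewrite defh groupX.
Qed.

End PowerStructure.

(** * Classes cut out by a labelled tree of cyclic subgroups *)

Section LabelledTree.

Variables (p t : nat) (gT : finGroupType) (G : {group gT}).
(** The setting abstracts the tree of cyclic subgroups: i : I is a leaf with
    subgroup C i, of order q; meet i j is the level of the highest node common
    to i and j; lbl m i is the label of the node of level m below i; and P is
    the set of the labels that every inner node passes to one extra child. *)
Variables (Om : nat -> {group gT}).
Variables (I : finType) (C : I -> {group gT}) (meet : I -> I -> nat).
Variables (K : finType) (lbl : nat -> I -> K) (P : pred K).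

Let q := (p ^ t)%N.
Local Notation ord g := (logn p #[g]%g).

Hypotheses (p_pr : prime p) (t_gt1 : (1 < t)%N).
Hypothesis oOm : forall m, (m <= t)%N -> #|Om m| = (p ^ (2 * m))%N.
Hypothesis Om_top : Om t :=: G.
Hypothesis Om_mono : forall m n, (m <= n)%N -> Om m \subset Om n.
Hypothesis nOm : forall m, G \subset 'N(Om m).
Hypothesis mem_Om : forall m g, g \in G -> (g \in Om m) = (ord g <= m)%N.
Hypothesis sCG : forall i, C i \subset G.
Hypothesis oC : forall i, #|C i| = q.
Hypothesis oCOm : forall i m, (m <= t)%N -> #|C i :&: Om m| = (p ^ m)%N.
Hypothesis le_meet : forall i j, (meet i j <= t)%N.
Hypothesis oCC : forall i j, #|C i :&: C j| = (p ^ meet i j)%N.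
Hypothesis mulCC : forall i j, C i * C j = C i * Om (t - meet i j).
Hypothesis mem_CC : forall i j g,
  g \in C i -> (g \in C j) = (ord g <= meet i j)%N.
Hypothesis cover_C : forall g, g \in G -> exists i, g \in C i.
Hypothesis eq_lbl : forall m i j,
  (0 < m)%N -> (m <= meet i j)%N -> lbl m i = lbl m j.
(** Above a node of level m, each label in P is created once for every node of
    the levels m to t - 1; a label of the node itself is passed on to exactly
    one leaf. *)
Hypothesis count_lbl : forall m i k, (0 < m <= t)%N ->
  #|[set j | (m <= meet i j)%N && (lbl t j == k)]|
    = ((lbl m i == k) + P k * geosum p (t - m))%N.

Local Open Scope ring_scope.

Let p_gt1 : (1 < p)%N := prime_gt1 p_pr.
Let p_neq0 : p%:R != 0 :> rat.
Proof. by rewrite pnatr_eq0 -lt0n prime_gt0. Qed.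

Let M := 'M[rat]_#|gT|.
Let J : M := conv G.
(** Up to a scalar, the idempotent of the group algebra that cuts out the
    characters trivial on Om m but not on Om m.+1. *)
Let delta m : M := p%:R ^+ 2 *: conv (Om m) - conv (Om m.+1).
Let Z : M := \sum_(1 <= l < t) (p%:R ^+ (t.-1 - l)) *: conv (Om l).
(** The coefficient of the identity in f k. *)
Definition degree k : rat :=
  #|[set i | lbl t i == k]|%:R - (P k * geosum p t.-1)%:R.
(* The class of label k plus a multiple of the identity, see f_label_class: in
   the sum over the nodes the inner levels collect into Z, since every node
   passes each label of P to one extra child. *)
Let f k : M := \sum_(i | lbl t i == k) conv (C i) - (P k)%:R *: Z.

(** The label of an element g of order p^m is the label of the node of level m
    that it generates. *)
Definition label_class k : {set gT} :=
  [set g in G | (g != 1%g) && [exists i, (g \in C i) && (lbl (ord g) i == k)]].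

Lemma OmM a b : (a <= b <= t)%N ->
  conv (Om a) *m conv (Om b) = p%:R ^+ (2 * a) *: conv (Om b).
Proof.
case/andP=> le_ab le_bt; have sab := Om_mono le_ab.
rewrite convM_group (setIidPl sab) mulSGid // oOm ?natrX //.
exact: leq_trans le_ab le_bt.
Qed.

Lemma OmC a b : (a <= t)%N -> (b <= t)%N ->
  conv (Om a) *m conv (Om b) = conv (Om b) *m conv (Om a).
Proof.
move=> le_at le_bt; rewrite !convM_group setIC (normC (B := Om b)) //.
by rewrite (subset_trans _ (nOm b)) // -Om_top Om_mono.
Qed.

Lemma COmC i m : conv (C i) *m conv (Om m) = conv (Om m) *m conv (C i).
Proof.
by rewrite !convM_group setIC (normC (B := Om m)) // (subset_trans (sCG i)).
Qed.

Lemma Cdelta i m : conv (C i) *m delta m = delta m *m conv (C i).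
Proof.
by rewrite mulmxBr mulmxBl -scalemxAr -scalemxAl !COmC.
Qed.

Lemma Om_delta l m : (l <= t)%N -> (m < t)%N ->
  conv (Om l) *m delta m = ((l <= m)%N%:R * p%:R ^+ (2 * l)) *: delta m.
Proof.
move=> le_lt lt_mt; rewrite mulmxBr -scalemxAr.
have [le_lm | lt_ml] := leqP l m.
  rewrite !OmM ?le_lm ?(ltnW lt_mt) ?lt_mt ?(leqW le_lm) // mul1r.
  by rewrite scalerBr !scalerA mulrC.
rewrite mul0r scale0r OmC ?(ltnW lt_mt) // OmM ?le_lt ?(ltnW lt_ml) //.
rewrite [X in _ - X]OmC // OmM ?le_lt ?lt_ml // scalerA.
by rewrite -exprD mulnS subrr.
Qed.

(** Two leaves with a common node of level s and none of a higher level
    multiply to a multiple of the first one times Om (t - s), and delta m kills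
    Om l as soon as l > m. On the part of the group algebra cut out by delta m,
    distinct nodes of level t - m are thus orthogonal. *)
Lemma C_delta_C i j m : (m < t)%N ->
  conv (C i) *m delta m *m conv (C j)
  = ((t - m <= meet i j)%N%:R * q%:R) *: (conv (C i) *m delta m).
Proof.
move=> lt_mt; rewrite -mulmxA -Cdelta mulmxA convM_group oCC mulCC.
set s := meet i j; have le_st : (s <= t)%N := le_meet i j.
have := convM_group (C i) (Om (t - s)); rewrite oCOm ?leq_subr // => defC.
have nz k : (p ^ k)%:R != 0 :> rat by rewrite natrX expf_neq0.
have -> : conv (C i * Om (t - s))%g
         = ((p ^ (t - s))%:R)^-1 *: (conv (C i) *m conv (Om (t - s))).
  by rewrite defC scalerA mulVf ?scale1r.
rewrite scalerA -scalemxAl -mulmxA Om_delta ?leq_subr // -scalemxAr scalerA.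
congr (_ *: _); rewrite leq_subCl mulrCA; congr (_ * _).
rewrite mul2n -addnn exprD -natrX mulrA divfK // -natrM -expnD.
by rewrite subnKC.
Qed.

Lemma sum_delta m : (m < t)%N ->
  \sum_(1 <= l < t) p%:R ^+ (t.-1 - l) * ((l <= m)%N%:R * p%:R ^+ (2 * l))
  = (q * geosum p m)%:R :> rat.
Proof.
move=> lt_mt; rewrite (big_cat_nat (n := m.+1)) //= addrC big_nat_cond.
rewrite big1 ?add0r => [|l /andP[/andP[lt_ml _] _]]; last first.
  by rewrite leqNgt lt_ml mul0r mulr0.
rewrite big_add1 /= /geosum big_distrr natr_sum /=.
apply: eq_big_nat => l /andP[_ lt_lm].
rewrite lt_lm mul1r -exprD /q -expnD natrX; congr (_ ^+ _).
by move: lt_lm lt_mt; lia.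
Qed.

Lemma Z_delta m : (m < t)%N -> Z *m delta m = (q * geosum p m)%:R *: delta m.
Proof.
move=> lt_mt; rewrite -sum_delta // scaler_suml mulmx_suml.
apply: eq_big_nat => l /andP[_ lt_lt].
by rewrite -scalemxAl Om_delta ?(ltnW lt_lt) // scalerA.
Qed.

Lemma deltaZC m : (m < t)%N -> delta m *m Z = Z *m delta m.
Proof.
move=> lt_mt; rewrite mulmx_sumr mulmx_suml; apply: eq_big_nat.
move=> l /andP[_ /ltnW lt_lt]; rewrite -scalemxAr -scalemxAl; congr (_ *: _).
rewrite mulmxBr mulmxBl -scalemxAr -scalemxAl (OmC lt_lt) ?(ltnW lt_mt) //.
by rewrite (OmC lt_lt).
Qed.

(** By count_lbl the leaves with label k above the node of C i contribute q
    (lbl (t - m) i == k) plus a term that only depends on whether k lies in P,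
    and this term is exactly cancelled by Z. *)
Lemma C_delta_f i m k : (m < t)%N ->
  conv (C i) *m delta m *m f k
  = (q%:R * (lbl (t - m) i == k)%:R) *: (conv (C i) *m delta m).
Proof.
move=> lt_mt; rewrite mulmxBr mulmx_sumr.
under eq_bigr do rewrite C_delta_C //.
rewrite -scaler_suml -scalemxAr -mulmxA deltaZC // Z_delta //.
rewrite -scalemxAr scalerA -scalerBl; congr (_ *: _).
rewrite -mulr_suml big_mkcond.
have -> : \sum_j (if lbl t j == k then (t - m <= meet i j)%N%:R else 0)
          = #|[set j | (t - m <= meet i j)%N && (lbl t j == k)]|%:R :> rat.
  rewrite -sum1dep_card natr_sum [RHS]big_mkcond; apply: eq_bigr => j _.
  by rewrite andbC; case: (_ == k); case: (_ <= _)%N.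
rewrite count_lbl ?subn_gt0 ?lt_mt ?leq_subr // subKn ?(ltnW lt_mt) //.
by rewrite natrD !natrM; ring.
Qed.

Lemma full_f k : J *m f k = (degree k * q%:R) *: J.
Proof.
have JC i : J *m conv (C i) = q%:R *: J.
  by rewrite /J -Om_top -COmC Om_top convMG // oC.
rewrite mulmxBr mulmx_sumr; under eq_bigr do rewrite JC.
rewrite sumr_const -scalemxAr -scaler_nat scalerA.
have -> : J *m Z = (q * geosum p t.-1)%:R *: J.
  have lt_tt : (t.-1 < t)%N by rewrite prednK ?(ltnW t_gt1).
  rewrite -(sum_delta lt_tt) scaler_suml mulmx_sumr.
  apply: eq_big_nat => l /andP[_ lt_lt]; rewrite -scalemxAr.
  rewrite /J -Om_top OmC ?(ltnW lt_lt) //.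
  rewrite OmM ?leqnn ?andbT ?(ltnW lt_lt) // scalerA.
  by rewrite -ltnS prednK ?(ltnW t_gt1) // lt_lt mul1r.
rewrite scalerA -scalerBl; congr (_ *: _); rewrite /degree cardsE.
by rewrite !natrM; ring.
Qed.

Lemma ord_le g : g \in G -> (ord g <= t)%N.
Proof. by move=> Gg; rewrite -mem_Om // Om_top. Qed.

Lemma ord_gt0 g : g \in G -> g != 1%g -> (0 < ord g)%N.
Proof.
move=> Gg; apply: contraNltn; rewrite -mem_Om // => O0g.
have /eqP : #|Om 0| = 1%N by rewrite oOm.
by rewrite -trivg_card1 => /eqP O0; move: O0g; rewrite O0 inE.
Qed.

Lemma mem_label_class i g k : g \in C i -> g != 1%g ->
  (g \in label_class k) = (lbl (ord g) i == k).
Proof.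
move=> Cg nt_g; have Gg := subsetP (sCG i) _ Cg; rewrite inE Gg nt_g /=.
apply/existsP/idP=> [[j /andP[Cjg]] | def_k]; last by exists i; rewrite Cg.
by rewrite (@eq_lbl _ i j) ?ord_gt0 // -mem_CC.
Qed.

Lemma sum_geo_from m : (0 < m <= t)%N ->
  \sum_(1 <= l < t) p%:R ^+ (t.-1 - l) * (m <= l)%N%:R
  = (geosum p (t - m))%:R :> rat.
Proof.
case/andP=> m_gt0 le_mt; rewrite (big_cat_nat (n := m)) //= big_nat_cond.
rewrite big1 ?add0r => [|l /andP[/andP[_ lt_lm] _]]; last first.
  by rewrite leqNgt lt_lm mulr0.
rewrite big_nat_rev -{1}[m]add0n big_addn /geosum natr_sum /=.
apply: eq_big_nat => l /andP[_ lt_l].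
have -> : (m <= m + t - (l + m).+1)%N by move: lt_l; lia.
by rewrite mulr1 natrX; congr (_ ^+ _); move: lt_l; lia.
Qed.

(** For g of order p^m, both the number of leaves through g and the coefficient
    of g in Z are geometric sums, up to the indicator of the label of g. *)
Lemma f_label_class k : f k = conv (label_class k) + (degree k)%:M.
Proof.
apply/matrixP=> u v; rewrite !mxE !summxE.
have -> : (u == v) = (gquo u v == 1%g).
  by rewrite /gquo -eq_mulgV1 (inj_eq enum_val_inj).
under eq_bigr do rewrite convE.
have -> : \sum_(1 <= l < t) (p%:R ^+ (t.-1 - l) *: conv (Om l)) u v
    = \sum_(1 <= l < t) p%:R ^+ (t.-1 - l) * (gquo u v \in Om l)%:R.
  by apply: eq_bigr => l _; rewrite mxE convE.
move: (gquo u v) => g; have [Gg | nGg] := boolP (g \in G); last first.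
  rewrite big1 => [|i _]; last first.
    have /negPf-> // : g \notin C i by apply: contra nGg;
      apply: subsetP (sCG i) g.
  rewrite big_nat big1 => [|l /andP[_ /ltnW le_lt]]; last first.
    have /negPf-> : g \notin Om l.
      by apply: contra nGg; apply: subsetP g; rewrite -Om_top Om_mono.
    by rewrite mulr0.
  have -> : (g == 1%g) = false by apply: contraNF nGg => /eqP->; rewrite group1.
  by rewrite inE (negPf nGg) /= !mulr0n mulr0 !addr0.
have [-> | nt_g] := eqVneq g 1%g.
  under eq_bigr do rewrite group1.
  rewrite sumr_const inE eqxx andbF add0r mulr1n /degree cardsE; congr (_ - _).
  have := @sum_geo_from 1; rewrite subn1 natrM => /(_ (ltnW t_gt1)) <-;
    congr (_ * _).
  by apply: eq_big_nat => l /andP[l_gt0 _]; rewrite group1 l_gt0.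
have [i Cg] := cover_C Gg;
  rewrite (mem_label_class _ Cg) // [_ *+ false]mulr0n addr0.
have ord_g : (0 < ord g <= t)%N by rewrite ord_gt0 ?ord_le.
have -> : \sum_(j | lbl t j == k) (g \in C j)%:R
          = #|[set j | (ord g <= meet i j)%N && (lbl t j == k)]|%:R :> rat.
  rewrite -sum1dep_card natr_sum big_mkcond [RHS]big_mkcond.
  apply: eq_bigr => j _; rewrite (mem_CC j Cg) andbC.
  by case: (_ == k); case: (_ <= _)%N.
rewrite count_lbl //; under eq_bigr do rewrite mem_Om //.
by rewrite sum_geo_from // natrD natrM addrK.
Qed.

Lemma label_class_inv k : ((label_class k)^-1 = label_class k)%g.
Proof.
apply/setP=> g; rewrite !inE groupV invg_eq1 orderV; congr [&& _, _ & _].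
by apply: eq_existsb => i; rewrite groupV.
Qed.

Lemma cover_label_class : \bigcup_k label_class k = (G^#)%g.
Proof.
apply/setP=> g; apply/bigcupP/setD1P=> [[k _] | [nt_g Gg]].
  by rewrite inE => /and3P[].
have [i Cg] := cover_C Gg; exists (lbl (ord g) i) => //.
by rewrite (mem_label_class _ Cg).
Qed.

Lemma label_class_inj k l g :
  g \in label_class k -> g \in label_class l -> k = l.
Proof.
move=> classk; move: (classk); rewrite inE => /and3P[Gg nt_g _].
have [i Cg] := cover_C Gg; move: classk.
by rewrite !(mem_label_class _ Cg nt_g) => /eqP <- /eqP.
Qed.

Let q_gt1 : (1 < q)%N.
Proof. by rewrite -(exp1n t) ltn_exp2r // (ltnW t_gt1). Qed.

Let oG : #|G| = (q ^ 2)%N.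
Proof. by rewrite -Om_top oOm // mulnC expnM. Qed.

Let J_neq0 : J != 0.
Proof.
apply/eqP=> /matrixP/(_ (enum_rank 1%g) (enum_rank 1%g))/eqP.
by rewrite convE !mxE /gquo mulgV group1 oner_eq0.
Qed.

Lemma f_fullC k : f k *m J = J *m f k.
Proof.
rewrite mulmxBr mulmxBl mulmx_sumr mulmx_suml -scalemxAr -scalemxAl.
congr (_ - _ *: _).
  by apply: eq_bigr => i _; rewrite /J -Om_top COmC.
rewrite mulmx_sumr mulmx_suml; apply: eq_big_nat => l /andP[_ /ltnW le_lt].
by rewrite -scalemxAr -scalemxAl /J -Om_top OmC.
Qed.

Lemma card_label_class k : #|label_class k|%:R = degree k * (q%:R - 1) :> rat.
Proof.
have sclassG : label_class k \subset G by apply/subsetP=> g;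
  rewrite inE => /andP[].
have := full_f k; rewrite -f_fullC f_label_class mulmxDl mul_scalar_mx convMG
  //.
rewrite -scalerDl => /eqP;
  rewrite -subr_eq0 -scalerBl scaler_eq0 (negPf J_neq0).
by rewrite orbF subr_eq0 mulrBr mulr1 => /eqP <-; rewrite addrK.
Qed.

Lemma sum_leaves :
  \sum_i conv (C i) = J + q%:R%:M + (\sum_k (P k)%:R : rat) *: Z.
Proof.
have := sum_classes degree cover_label_class label_class_inj.
rewrite (sum_degrees q_gt1 oG cover_label_class label_class_inj
  card_label_class) addrK => <-.
rewrite scaler_suml -big_split (partition_big (lbl t) xpredT) //=.
by apply: eq_bigr => k _; rewrite -f_label_class subrK.
Qed.

(** The leaves sum up to J + q plus a nonnegative multiple of Z, and this acts
    on the image of delta m as a positive scalar. *)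
Lemma delta_eq0 m (X : M) : (m < t)%N ->
  (forall i, conv (C i) *m (delta m *m X) = 0) -> delta m *m X = 0.
Proof.
move=> lt_mt CX; have : (\sum_i conv (C i)) *m (delta m *m X) = 0.
  by rewrite mulmx_suml big1.
have Jd : J *m delta m = 0.
  by rewrite /J -Om_top Om_delta // leqNgt lt_mt mul0r scale0r.
rewrite sum_leaves mulmxDl [(J + _) *m _]mulmxDl mul_scalar_mx.
rewrite (mulmxA J) Jd mul0mx add0r -scalemxAl (mulmxA Z) Z_delta //.
rewrite -scalemxAl scalerA -scalerDl => /eqP.
rewrite scaler_eq0 => /orP[|/eqP //];
  rewrite Order.POrderTheory.gt_eqF // ltr_wpDr //.
  by rewrite mulr_ge0 ?ler0n // sumr_ge0.
by rewrite ltr0n (ltnW q_gt1).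
Qed.

(** The elements delta k telescope: each of them turns Om k into Om k.+1. *)
Lemma Om_fixed (X : M) m : (m <= t)%N ->
  (forall k, (k < t)%N -> delta k *m X = 0) ->
  conv (Om m) *m X = p%:R ^+ (2 * m) *: X.
Proof.
move=> le_mt dX; elim: m le_mt => [|m IHm] lt_mt.
  have Om0 : Om 0 :=: 1%g by apply/eqP; rewrite trivg_card1 oOm.
  by rewrite Om0 conv1 mul1mx scale1r.
have /eqP := dX m lt_mt; rewrite mulmxBl -scalemxAl IHm ?(ltnW lt_mt) //.
by rewrite subr_eq0 scalerA -exprD mulnS => /eqP.
Qed.

(** By C_delta_f, each C i delta m is a common eigenvector of f k and f l, and
    one of the two eigenvalues is 0. So the product f k f l is killed by all
    the delta m, and it is a multiple of J. *)
Lemma f_mul k l : k != l -> f k *m f l = (degree k * degree l) *: J.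
Proof.
move=> neq_kl; pose X := f k *m f l.
have dX m : (m < t)%N -> delta m *m X = 0.
  move=> lt_mt; apply: delta_eq0 => // i; rewrite !mulmxA C_delta_f //.
  rewrite -scalemxAl C_delta_f // scalerA.
  case: eqP => [-> | _]; last by rewrite mulr0 mul0r scale0r.
  by rewrite (negPf neq_kl) !mulr0 scale0r.
have : J *m (f k *m f l) = p%:R ^+ (2 * t) *: (f k *m f l).
  by rewrite /J -Om_top Om_fixed.
rewrite mulmxA full_f -scalemxAl full_f scalerA => defX.
apply: (@scalerI _ _ (p%:R ^+ (2 * t))); first by rewrite expf_neq0.
rewrite -defX scalerA; congr (_ *: _).
by rewrite mulnC exprM /q natrX; ring.
Qed.

Lemma degree_eq0 k : (label_class k == set0) = (degree k == 0).
Proof.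
rewrite -cards_eq0 -(eqr_nat rat) card_label_class mulf_eq0 orbC.
by rewrite (negPf (q_neq1 q_gt1)).
Qed.

Lemma amorphic_of_tree : (forall k, degree k != 0) ->
  amorphic_scheme_on_group G [set label_class k | k : K] #|K|.
Proof.
move=> nz_degree; apply: (amorphic_scheme_of_latin q_gt1 oG cover_label_class
  label_class_inj).
- exact: label_class_inv.
- exact: card_label_class.
- by move=> k l neq_kl; rewrite -!f_label_class f_mul.
by move=> k; rewrite degree_eq0.
Qed.

Lemma pds_of_tree (A : {set K}) : 2 * (\sum_(k in A) degree k) = q%:R + 1 ->
  regular_pds G (\bigcup_(k in A) label_class k) (q ^ 2) ((q ^ 2 - 1) %/ 2)
    ((q ^ 2 - 5) %/ 4) ((q ^ 2 - 1) %/ 4).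
Proof.
move=> halfA; apply: (regular_pds_half q_gt1 oG cover_label_class
  label_class_inj) halfA.
- exact: label_class_inv.
- exact: card_label_class.
by move=> k l neq_kl; rewrite -!f_label_class f_mul.
Qed.

End LabelledTree.

(** * The tree of the group and its classes *)

Section LeafTree.

Variables (p t : nat) (gT : finGroupType) (G : {group gT}) (x y : gT).
Hypotheses (p_pr : prime p) (p_odd : odd p) (t_gt1 : (1 < t)%N).
Hypothesis sdG : Ghat_sdprod p t G x y.

Let q := (p ^ t)%N.
Let p_gt0 : (0 < p)%N := prime_gt0 p_pr.
Let p_gt1 : (1 < p)%N := prime_gt1 p_pr.
Let t_gt0 : (0 < t)%N := ltnW t_gt1.

(** Labels are numbered from 0: P_i has label i - 1, S_j has label p - 1 + j
    and S_inf has label 2 p - 1. At level 1 the p + 1 nodes carry the labels of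
    the S-classes. *)
Definition root_label (b : bool) (w : nat) : nat :=
  if b then (2 * p).-1 else (p.-1 + w %% p)%N.

Lemma root_label_lt b w : (root_label b w < 2 * p)%N.
Proof.
by have := ltn_pmod w p_gt0; rewrite /root_label; move: p_gt0; case: b; lia.
Qed.

Lemma root_label_ge b w : (p.-1 <= root_label b w)%N.
Proof. by rewrite /root_label; move: p_gt0; case: b; lia. Qed.

(** The label of the node of level m below a leaf; it is determined by the
    digits of w at the positions 0 to m - 1, and so it is meant for m > 0. *)
Definition leaf_label (m : nat) (b : bool) (w : nat) :=
  top_digit p (root_label b w) w m.-1.

Lemma leaf_label_lt m b w : (leaf_label m b w < 2 * p)%N.
Proof.
rewrite /leaf_label; have [[-> _]|[d [r [ltd _ -> _]]]] := top_digitP p_gt1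
  (root_label b w) w m.-1.
  exact: root_label_lt.
by move: ltd; lia.
Qed.

Lemma eq_leaf_label m b w b' w' : (0 < m)%N -> agree p m b w b' w' ->
  leaf_label m b w = leaf_label m b' w'.
Proof.
case: m => // m _ /andP[/eqP <- /eqP eqw]; rewrite /leaf_label /=.
have -> : root_label b w = root_label b w'.
  have dvd_p : p %| p ^ m.+1 by rewrite dvdn_exp.
  by rewrite /root_label -(modn_dvdm w dvd_p) eqw modn_dvdm.
exact: eq_top_digit eqw.
Qed.

Definition leaf_index := {c : bool * 'I_(p ^ t) | valid p c.1 c.2}.
Implicit Types i j : leaf_index.

Let C i : {group gT} := <[gen x y (val i).1 (val i).2]>%G.
Let Om := Om_group p_pr p_odd t_gt1 sdG.
Let meet i j := logn p #|C i :&: C j|.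
Let lbl m i : 'I_(2 * p) := Ordinal (leaf_label_lt m (val i).1 (val i).2).
Let P (k : 'I_(2 * p)) := (k < p.-1)%N.

Let oCC i j : #|C i :&: C j| = (p ^ meet i j)%N.
Proof.
have [l _ oI] := card_sub_leaf p_pr p_odd t_gt1 sdG
  (subsetIl (C i) (C j) : _ \subset leaf x y (val i).1 (val i).2).
by rewrite /meet oI pfactorK.
Qed.

Let le_meet i j : (meet i j <= t)%N.
Proof.
rewrite -(leq_exp2l _ _ p_gt1) -oCC.
rewrite -(card_leaf p_pr p_odd t_gt1 sdG (val i).1 (val i).2).
exact: subset_leq_card (subsetIl _ _).
Qed.

Let agree_meet i j m : (m <= t)%N ->
  agree p m (val i).1 (val i).2 (val j).1 (val j).2 = (m <= meet i j)%N.
Proof.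
by move=> le_mt; apply: (agree_leq p_pr p_odd t_gt1 sdG) (oCC i j);
   rewrite ?(valP i) ?(valP j).
Qed.

Let eq_lbl m i j : (0 < m)%N -> (m <= meet i j)%N -> lbl m i = lbl m j.
Proof.
move=> m_gt0 le_m; apply: val_inj => /=; apply: eq_leaf_label => //.
by rewrite agree_meet // (leq_trans le_m).
Qed.

Let order_pow g : g \in G -> #[g] = (p ^ logn p #[g])%N.
Proof.
move=> Gg; have : #[g] %| q ^ 2 by rewrite -(card_G sdG) order_dvdG.
by rewrite /q -expnM => /(dvdn_pfactor _ _ p_pr)[l _ ->]; rewrite pfactorK.
Qed.

Let mem_Om_ord m g : g \in G -> (g \in Om m) = (logn p #[g] <= m)%N.
Proof.
move=> Gg; rewrite /= (mem_Om p m Gg) -order_dvdn order_pow //.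
by rewrite pfactorK // dvdn_Pexp2l.
Qed.

Let sCG i : C i \subset G := leaf_sub sdG _ _.
Let oC i : #|C i| = (p ^ t)%N := card_leaf p_pr p_odd t_gt1 sdG _ _.
Let oCOm i m : (m <= t)%N -> #|C i :&: Om m| = (p ^ m)%N :=
  @card_leaf_Om _ _ _ _ _ _ p_pr p_odd t_gt1 sdG _ _ m.

Let mem_CC i j g : g \in C i -> (g \in C j) = (logn p #[g] <= meet i j)%N.
Proof.
move=> Cg; have Gg := subsetP (sCG i) g Cg.
have defI : C i :&: C j = C i :&: Om (meet i j).
  have sI : C i :&: C j \subset C i := subsetIl _ _.
  have := sub_cycle p_pr (order_gen p_pr p_odd t_gt1 sdG _ _) (le_meet i j) sI
    (oCC i j).
  by rewrite -(leaf_Om p_pr p_odd t_gt1 sdG).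
by rewrite -mem_Om_ord //; move/setP/(_ g): defI; rewrite !inE Cg.
Qed.

Let mulCC i j : C i * C j = C i * Om (t - meet i j).
Proof.
exact: (mul_leaf p_pr p_odd t_gt1 sdG (valP i) (valP j) (oCC i j)).
Qed.

Lemma leaf_indexP b w : valid p b w -> (w < q)%N ->
  exists i, (val i).1 = b /\ (val i).2 = w :> nat.
Proof. by move=> vbw ltw; exists (Sub (b, Ordinal ltw) vbw : leaf_index). Qed.

Let cover_C g : g \in G -> exists i, g \in C i.
Proof.
case/(leaf_cover p_pr p_odd t_gt1 sdG) => b [w [vbw ltw Cg]].
by have [i [ib iw]] := leaf_indexP vbw ltw; exists i; rewrite /= ib iw.
Qed.

(** Counting leaves amounts to counting residues, on which count_top_digit
    applies. *)
Lemma card_leaves (Q : bool -> nat -> bool) :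
  #|[set j : leaf_index | Q (val j).1 (val j).2]|
  = \sum_(b : bool) \sum_(0 <= w < q) (valid p b w && Q b w : nat).
Proof.
rewrite -(card_imset _ val_inj).
have -> : [set val j | j in [set j : leaf_index | Q (val j).1 (val j).2]]
          = [set c : bool * 'I_(p ^ t) | valid p c.1 c.2 && Q c.1 c.2].
  apply/setP=> c; rewrite inE; apply/imsetP/andP=> [[j] | [vc Qc]].
    by rewrite inE => Qj ->; rewrite (valP j).
  by exists (Sub c vc : leaf_index); rewrite ?inE SubK.
rewrite -sum1dep_card big_mkcond.
under [RHS]eq_bigr do rewrite big_mkord.
by rewrite pair_big; apply: eq_bigr => c _; case: (_ && _).
Qed.

Lemma root_label_mod b w : root_label b (w %% p) = root_label b w.
Proof. by rewrite /root_label modn_mod. Qed.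

(** count_top_digit for one of the two charts of the projective line. *)
Lemma count_side (Q : pred nat) b m k : (0 < m <= t)%N ->
  \sum_(0 <= w < q) (Q (w %% p ^ m) && (leaf_label t b w == k) : nat)
  = (\sum_(0 <= w < p ^ m) (Q w && (leaf_label m b w == k))
     + (k < p.-1) * (\sum_(0 <= w < p ^ m) Q w) * geosum p (t - m))%N.
Proof.
case/andP=> m_gt0 le_mt; have := count_top_digit p_gt1 Q (root_label b) m.-1 (t
  - m) k.
have -> : (t - m + m.-1 = t.-1)%N by move: m_gt0 le_mt; lia.
rewrite !prednK // => count;
  under eq_bigr do rewrite /leaf_label -root_label_mod.
by rewrite count; congr (_ + _)%N; apply: eq_bigr => w _;
  rewrite root_label_mod.
Qed.

Let count_lbl m i (k : 'I_(2 * p)) : (0 < m <= t)%N ->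
  #|[set j | (m <= meet i j)%N && (lbl t j == k)]|
    = ((lbl m i == k) + P k * geosum p (t - m))%N.
Proof.
move=> mt; case/andP: (mt) => m_gt0 le_mt.
transitivity #|[set j : leaf_index |
    agree p m (val i).1 (val i).2 (val j).1 (val j).2
    && (leaf_label t (val j).1 (val j).2 == k)]|.
  by apply: eq_card => j; rewrite !inE agree_meet.
rewrite (card_leaves (fun b' w' =>
  agree p m (val i).1 (val i).2 b' w' && (leaf_label t b' w' == k))).
rewrite -(inj_eq val_inj) /=.
have := valP i; move: (val i).1 (val i).2 => b w /= vbw.
rewrite (bigD1 b) //= [X in (_ + X)%N]big1 ?addn0 => [|b' /negPf neqb];
  last first.
  by rewrite big1 // => w' _;
    rewrite /agree [b == b']eq_sym neqb eqn0Ngt m_gt0 andbF.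
pose Q w' := w' == w %% p ^ m.
transitivity (\sum_(0 <= w' < q)
    (Q (w' %% p ^ m) && (leaf_label t b w' == k) : nat)).
  apply: eq_bigr => w' _; rewrite /agree eqn0Ngt m_gt0 eqxx /= [w %% _ ==
    _]eq_sym.
  rewrite -/(Q _); case: (Q _) / eqP => [eqw | _]; last by rewrite andbF.
  rewrite /= (_ : valid p b w' = true) //; case: b vbw => //= dvd_w.
  have dvd_p : p %| p ^ m by rewrite -(prednK m_gt0) dvdn_exp.
  by rewrite /valid /dvdn -(modn_dvdm w' dvd_p) eqw modn_dvdm.
have lt_w : (w %% p ^ m < p ^ m)%N by rewrite ltn_mod expn_gt0 p_gt0.
rewrite count_side // /P; congr (_ + _ * _)%N.
  rewrite (bigD1_seq (w %% p ^ m)%N) ?iota_uniq ?mem_index_iota //= /Q eqxx /=.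
  rewrite [X in (_ + X)%N]big1 ?addn0 => [|w' /negPf-> //].
  rewrite (@eq_leaf_label m b (w %% p ^ m) b w) //.
  by rewrite /agree eqxx modn_mod eqxx orbT.
rewrite (bigD1_seq (w %% p ^ m)%N) ?iota_uniq ?mem_index_iota //= /Q eqxx.
by rewrite big1 ?muln1 // => w' /negPf->.
Qed.

(** The S-classes have degree 1, and the P-classes have degree (q - p) / (p -
    1). *)
Lemma degreeE (k : 'I_(2 * p)) :
  degree p t lbl P k
  = ((p.-1 <= k) + (k < p.-1) * (p * geosum p t.-1))%:R%R.
Proof.
have infE : \sum_(0 <= w < q)
      (valid p true w && (leaf_label t true w == k) : nat)
    = ((k == (2 * p).-1 :> nat) + P k * geosum p t.-1)%N.
  have := @count_side (fun w => w == 0%N) true 1 k t_gt0.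
  rewrite expn1 subn1 /valid => {1}->.
  have p_range : 0%N \in index_iota 0 p by rewrite mem_index_iota.
  rewrite !(bigD1_seq 0%N) ?iota_uniq //= !big1 ?addn0 ?muln1 => [|w /negPf->|w
    /negPf->] //.
  by rewrite /leaf_label /= eq_sym.
have finE : \sum_(0 <= w < q)
      (valid p false w && (leaf_label t false w == k) : nat)
    = ((p.-1 <= k < (2 * p).-1) + P k * p * geosum p t.-1)%N.
  have := @count_side xpredT false 1 k t_gt0.
  rewrite expn1 subn1 /valid /= => ->; rewrite sum_nat_const_nat subn0 muln1.
  congr (_ + _)%N; case: (boolP (_ <= k < _)) => [/andP[le_k lt_k] | nk].
    rewrite (bigD1_seq (k - p.-1)%N) ?iota_uniq //=; last first.
      by rewrite mem_index_iota; move: le_k lt_k p_gt0; lia.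
    rewrite /leaf_label /= modn_small; last by move: le_k lt_k p_gt0; lia.
    rewrite subnKC // eqxx big_nat_cond big1 // => w /andP[/andP[_ ltw] /negPf
      nw].
    by rewrite modn_small // -(eqn_add2l p.-1) subnKC // in nw *; rewrite nw.
  rewrite big_nat_cond big1 // => w /andP[/andP[_ ltw] _].
  rewrite /leaf_label /= modn_small //; apply/eqP; rewrite eqb0.
  by apply: contraNneq nk => <-; move: ltw p_gt0; lia.
rewrite /degree (card_leaves (fun b w => leaf_label t b w == k)) big_bool infE
  finE.
rewrite /P -natrB; last by case: (k < _)%N; rewrite /=; lia.
congr (_%:R)%R; have ltk2p := ltn_ord k.
have [lt_k | le_k] := ltnP k p.-1;
  rewrite /= ?mul1n ?mul0n ?addn0 ?add0n ?subn0.
  by rewrite ltn_eqF ?addKn //; move: lt_k p_gt1; lia.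
by rewrite eqn_leq; move: le_k ltk2p p_gt1; lia.
Qed.

Let D k := label_class p G C lbl k.

Lemma amorphic_leaf_classes :
  amorphic_scheme_on_group G [set D k | k : 'I_(2 * p)] (2 * p).
Proof.
rewrite -[X in amorphic_scheme_on_group _ _ X](card_ord (2 * p)).
apply: (amorphic_of_tree (t := t) (Om := Om) (meet := meet) (P := P)) => //.
- by move=> m; apply: (card_Om p_pr p_odd t_gt1 sdG).
- exact: (Om_t p_pr p_odd t_gt1 sdG).
- exact: Om_S.
- exact: Om_norm.
move=> k; rewrite degreeE pnatr_eq0; have := ltn_ord k.
have : (0 < p * geosum p t.-1)%N.
  rewrite muln_gt0 p_gt0 /= -(prednK (_ : 0 < t.-1)%N) ?geosumS ?addn_gt0.
    by rewrite expn_gt0 p_gt0 orbT.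
  by rewrite -ltnS prednK.
by case: ltnP; lia.
Qed.

Lemma pds_leaf_classes (A : {set 'I_(2 * p)}) :
    (2 * (\sum_(k in A) degree p t lbl P k) = (p ^ t)%:R + 1)%R ->
  regular_pds G (\bigcup_(k in A) D k) (q ^ 2) ((q ^ 2 - 1) %/ 2)
    ((q ^ 2 - 5) %/ 4) ((q ^ 2 - 1) %/ 4).
Proof.
apply: (pds_of_tree (t := t) (Om := Om) (meet := meet) (P := P)) => //.
- by move=> m; apply: (card_Om p_pr p_odd t_gt1 sdG).
- exact: (Om_t p_pr p_odd t_gt1 sdG).
- exact: Om_S.
exact: Om_norm.
Qed.

Lemma mem_leaf_class g b w k : valid p b w -> (w < q)%N ->
    g \in leaf x y b w -> g != 1 ->
  (g \in D k) = (leaf_label (logn p #[g]) b w == k).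
Proof.
move=> vbw ltw; have [i [<- <-]] := leaf_indexP vbw ltw => Cg nt_g.
rewrite -[RHS]/(lbl (logn p #[g]) i == k).
apply: (mem_label_class (t := t) (Om := Om) (meet := meet)) => //.
by move=> m; apply: (card_Om p_pr p_odd t_gt1 sdG).
Qed.

Lemma leaf_classP g (k : 'I_(2 * p)) : reflect
  (exists b w, [/\ valid p b w, (w < q)%N, g \in leaf x y b w, g != 1
                 & leaf_label (logn p #[g]) b w = k]) (g \in D k).
Proof.
apply: (iffP idP) => [Dg | [b [w [vbw ltw Cg nt_g labk]]]]; last first.
  by rewrite (mem_leaf_class _ vbw ltw) // labk.
have [Gg nt_g] : g \in G /\ g != 1 by move: Dg; rewrite inE => /and3P[].
have [b [w [vbw ltw Cg]]] := leaf_cover p_pr p_odd t_gt1 sdG Gg.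
exists b, w; split=> //; apply/eqP.
by rewrite -(mem_leaf_class k vbw ltw).
Qed.

Lemma mem_bigcup_nat (T : finType) (F : nat -> {set T}) m n u :
  reflect (exists2 i, (m <= i < n)%N & u \in F i)
          (u \in \bigcup_(m <= i < n) F i).
Proof.
rewrite big_tnth; apply: (iffP bigcupP) => [[k _ Fu] | [i mi Fu]].
  by exists (tnth (in_tuple (index_iota m n)) k);
    rewrite // -mem_index_iota mem_tnth.
have /(tnthP (in_tuple _))[k defk] : i \in index_iota m n by rewrite
  mem_index_iota.
by exists k; rewrite // -defk.
Qed.

(** Taking away the p^(t - r)-th powers leaves the elements of order greater
    than p^r. *)
Lemma leaf_setD b w r g : (r <= t)%N ->
  (g \in leaf x y b w :\: <[gen x y b w ^+ (p ^ (t - r))]>)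
  = (g \in leaf x y b w) && (r < logn p #[g])%N.
Proof.
move=> le_rt; rewrite -(leaf_Om p_pr p_odd t_gt1 sdG b w le_rt) setDIr setDv
  set0U.
rewrite inE andbC; apply: andb_id2l => Cg.
by rewrite (mem_Om_ord r (subsetP (leaf_sub sdG b w) g Cg)) ltnNge.
Qed.

Lemma same_leaf b w w' g : valid p b w -> valid p b w' ->
    (w < q)%N -> (w' < q)%N -> g \in leaf x y b w ->
  w = w' %[mod p ^ logn p #[g]] -> g \in leaf x y b w'.
Proof.
move=> vw vw' ltw ltw' Cg eqw; have [i [ib iw]] := leaf_indexP vw ltw.
have [j [jb jw]] := leaf_indexP vw' ltw'.
have Cig : g \in C i by rewrite /= ib iw.
have Gg := subsetP (sCG i) g Cig.
suffices: g \in C j by rewrite /= jb jw.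
rewrite (mem_CC j Cig) -agree_meet.
  by rewrite /agree ib jb iw jw eqxx eqw eqxx orbT.
rewrite -(leq_exp2l _ _ p_gt1) -order_pow // -(oC i) dvdn_leq ?cardG_gt0 //.
exact: order_dvdG Cig.
Qed.

(** The digit i at position r is invisible in the p^(t - r)-th powers; so the
    subgroups removed in the definition of Phat, which do not mention i, are
    the subgroups of order p^r of the leaves. *)
Lemma expn_shift (i r s : nat) : (r <= t)%N ->
  (i * p ^ r + s) * p ^ (t - r) = s * p ^ (t - r) %[mod q].
Proof. by move=> le_rt; rewrite mulnDl -mulnA -expnD subnKC // modnMDl. Qed.

Lemma Phat_fin (i r j k : nat) : (r < t)%N ->
  <[x * y ^+ (i * p ^ r + p * j + k)]>
    :\: <[x ^+ (p ^ (t - r)) * y ^+ (j * p ^ (t + 1 - r) + k * p ^ (t - r))]>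
  = leaf x y false (i * p ^ r + (p * j + k))
    :\: <[gen x y false (i * p ^ r + (p * j + k)) ^+ (p ^ (t - r))]>.
Proof.
move=> lt_rt; have le_rt := ltnW lt_rt.
rewrite (gen_exp p_pr p_odd t_gt1 sdG) /leaf /gen addnA;
  congr (_ :\: <[_ * _]>).
apply/eqP; rewrite eq_expg_mod_order (order_y sdG) -addnA expn_shift //.
by rewrite mulnDl -(addnBAC 1 le_rt) addn1 expnS mulnCA mulnA.
Qed.

Lemma Phat_inf (i r j : nat) : (r < t)%N ->
  <[x ^+ (i * p ^ r + j * p) * y]>
    :\: <[x ^+ (j * p ^ (t - r + 1)) * y ^+ (p ^ (t - r))]>
  = leaf x y true (i * p ^ r + j * p)
    :\: <[gen x y true (i * p ^ r + j * p) ^+ (p ^ (t - r))]>.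
Proof.
move=> lt_rt; have le_rt := ltnW lt_rt.
rewrite (gen_exp p_pr p_odd t_gt1 sdG) /leaf /gen; congr (_ :\: <[_ * _]>).
apply/eqP; rewrite eq_expg_mod_order (order_x sdG) expn_shift //.
by rewrite addn1 expnS mulnA.
Qed.

Lemma digit_lt (i r s : nat) : (i < p)%N -> (r < t)%N -> (s < p ^ r)%N ->
  (i * p ^ r + s < q)%N.
Proof.
move=> lt_ip lt_rt lt_s; rewrite (@leq_trans (i.+1 * p ^ r)) //.
  by rewrite mulSn addnC ltn_add2r.
by rewrite (leq_trans (leq_mul lt_ip (leqnn _))) // -expnS leq_exp2l.
Qed.

(** The exponents i p^r + p j + k and i p^r + j p run over the residues whose
    highest nonzero digit is i, at position r, and only elements of order
    greater than p^r see this digit. Each element of label i - 1 is thus in the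
    term of Phat given by the position r of the highest nonzero digit of its
    node. *)
Lemma Phat_class (i : nat) (lt_i : (i.-1 < 2 * p)%N) : (0 < i < p)%N ->
  Phat p t x y i = D (Ordinal lt_i).
Proof.
move=> ip; have /andP[i_gt0 lt_ip] := ip.
apply/setP=> g; apply/mem_bigcup_nat/leaf_classP.
  case=> r /andP[r_gt0 lt_rt] /mem_bigcup_nat[j /andP[_ lt_j] Pg].
  have [b [s [lt_s vs]]] : exists b s, [/\ (s < p ^ r)%N, valid p b s &
      g \in leaf x y b (i * p ^ r + s)
             :\: <[gen x y b (i * p ^ r + s) ^+ (p ^ (t - r))]>].
    case/setUP: Pg => [/mem_bigcup_nat[k /andP[_ lt_k]] | ].
      rewrite Phat_fin // => Pg; exists false, (p * j + k)%N; split=> //.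
      rewrite -(subnKC r_gt0) expnD expn1 (@leq_trans (p * j.+1)) //.
        by rewrite mulnS addnC ltn_add2r.
      by rewrite leq_mul2l lt_j orbT.
    rewrite Phat_inf // => Pg; exists true, (j * p)%N; split=> //; last first.
      by rewrite /valid dvdn_mull.
    by rewrite -(subnK r_gt0) expnD expn1 ltn_mul2r p_gt0.
  rewrite leaf_setD ?(ltnW lt_rt) // => /andP[Cg lt_r_ord].
  exists b, (i * p ^ r + s)%N; split=> //.
  - by case: b vs {Cg} => //= dvd_s;
    rewrite /valid /= dvdn_add ?dvdn_mull // dvdn_exp.
  - exact: digit_lt.
  - by apply: contraTneq lt_r_ord => ->; rewrite order1 logn1.
  by rewrite /leaf_label top_digit_lead // r_gt0 -ltnS prednK // (leq_trans _
    lt_r_ord).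
case=> b [w [vw ltw Cg nt_g labw]]; set m := logn p #[g] in labw.
have Gg := subsetP (leaf_sub sdG b w) g Cg.
have m_gt0 : (0 < m)%N.
  by rewrite lt0n; apply: contra nt_g => /eqP m0;
    rewrite -order_eq1 order_pow // -/m m0.
have le_mt : (m <= t)%N.
  rewrite -(leq_exp2l _ _ p_gt1) /m -order_pow //.
  by rewrite -(card_leaf p_pr p_odd t_gt1 sdG b w) dvdn_leq ?cardG_gt0
    ?order_dvdG.
have [[eq_base _]|[d [r [dp rm labd defw]]]] := top_digitP p_gt1 (root_label b
  w) w m.-1.
  have := root_label_ge b w; move: labw; rewrite /leaf_label eq_base /= => ->.
  by move: i_gt0 lt_ip; lia.
have eq_di : d = i by move: labw i_gt0 dp; rewrite /leaf_label labd /=; lia.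
rewrite {}eq_di {d dp labd} prednK // in defw *.
have /andP[r_gt0 lt_rm] : (0 < r < m)%N by case/andP: rm => ->;
  rewrite -ltnS prednK.
have lt_rt : (r < t)%N := leq_trans lt_rm le_mt.
have lt_s : (w %% p ^ r < p ^ r)%N by rewrite ltn_mod expn_gt0 p_gt0.
have dvd_p : p %| p ^ r by rewrite dvdn_exp.
have vW : valid p b (i * p ^ r + w %% p ^ r).
  by case: b vw {Cg labw} => //= dvd_w;
    rewrite /valid /= dvdn_add ?dvdn_mull // /dvdn modn_dvdm.
have Wq := digit_lt lt_ip lt_rt lt_s.
have CWg : g \in leaf x y b (i * p ^ r + w %% p ^ r).
  by apply: (same_leaf vw) => //; rewrite -/m -defw modn_mod.
have PWg : g \in leaf x y b (i * p ^ r + w %% p ^ r)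
    :\: <[gen x y b (i * p ^ r + w %% p ^ r) ^+ (p ^ (t - r))]>.
  by rewrite leaf_setD ?(ltnW lt_rt) // CWg.
exists r; first by rewrite r_gt0.
have ltj : (w %% p ^ r %/ p < p ^ (r - 1))%N.
  by rewrite ltn_divLR // -expnSr subn1 prednK.
apply/mem_bigcup_nat; exists (w %% p ^ r %/ p)%N => //; apply/setUP.
case: b vw vW PWg {Cg labw CWg} => vw vW PWg; [right | left].
  rewrite Phat_inf // divnK // /dvdn modn_dvdm //.
apply/mem_bigcup_nat; exists (w %% p ^ r %% p)%N; first by rewrite ltn_mod.
by rewrite Phat_fin // [(p * _)%N]mulnC -divn_eq.
Qed.

Lemma Shat_class (j : nat) (lt_j : (p.-1 + j < 2 * p)%N) : (j < p)%N ->
  Shat x y j = D (Ordinal lt_j).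
Proof.
move=> lt_jp; apply/setP=> g; have lt_jq : (j < q)%N.
  by rewrite (leq_trans lt_jp) // /q -{1}[p]expn1 leq_exp2l.
apply/setD1P/leaf_classP=> [[nt_g Cg] | [b [w [vw ltw Cg nt_g]]]].
  by exists false, j; split=> //;
    rewrite /leaf_label top_digit_small //= modn_small.
rewrite /leaf_label; have [[-> defw]|[d [r [dp _ -> _]]]] := top_digitP p_gt1
  (root_label b w) w (logn p #[g]).-1; last first.
  by move=> /= defd; move: dp; lia.
have lt_w := ltn_pmod w p_gt0.
case: b vw Cg => vw Cg /= defj; first by move: defj lt_jp p_gt0; lia.
have {}defj : (w %% p = j)%N by move/eqP: defj; rewrite eqn_add2l => /eqP.
split=> //; apply: (same_leaf vw) => //.
have Gg := subsetP (leaf_sub sdG _ _) g Cg.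
have m_gt0 : (0 < logn p #[g])%N.
  by rewrite lt0n; apply: contra nt_g => /eqP m0;
    rewrite -order_eq1 order_pow // m0.
rewrite prednK // in defw; rewrite defw defj modn_small //.
by rewrite (leq_trans lt_jp) // -{1}[p]expn1 leq_exp2l.
Qed.

Lemma Shat_inf_class (lt_inf : ((2 * p).-1 < 2 * p)%N) :
  Shat_inf y = D (Ordinal lt_inf).
Proof.
have leaf0 : leaf x y true 0 = <[y]> by rewrite /leaf /gen expg0 mul1g.
have v0 : valid p true 0 := dvdn0 p.
have q_gt0 : (0 < q)%N by rewrite /q expn_gt0 p_gt0.
rewrite /Shat_inf -leaf0; apply/setP=> g.
apply/setD1P/leaf_classP=> [[nt_g Cg] | [b [w [vw ltw Cg nt_g]]]].
  by exists true, 0%N; split=> //; rewrite /leaf_label top_digit_small.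
rewrite /leaf_label; have [[-> defw]|[d [r [dp _ -> _]]]] := top_digitP p_gt1
  (root_label b w) w (logn p #[g]).-1; last first.
  by move=> /= defd; move: dp; lia.
have lt_w := ltn_pmod w p_gt0.
case: b vw Cg => vw Cg /= defj; last by move: defj lt_w p_gt0; lia.
split=> //; apply: (same_leaf vw) => //.
have Gg := subsetP (leaf_sub sdG _ _) g Cg.
have m_gt0 : (0 < logn p #[g])%N.
  by rewrite lt0n; apply: contra nt_g => /eqP m0;
    rewrite -order_eq1 order_pow // m0.
by rewrite prednK // in defw; rewrite defw mod0n; apply/eqP.
Qed.

Lemma Ghat_classesE : Ghat_classes p t x y = [set D k | k : 'I_(2 * p)].
Proof.
apply/setP=> A; apply/setUP/imsetP.
  case=> [/setUP[/imsetP[i i_gt0 ->] | /imsetP[j _ ->]] | /set1P ->].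
  - have lt_i : (i.-1 < 2 * p)%N by have := ltn_ord i; lia.
    exists (Ordinal lt_i); rewrite // -Phat_class // ltn_ord andbT.
    by rewrite inE in i_gt0.
  - have lt_j : (p.-1 + j < 2 * p)%N by have := ltn_ord j; lia.
    by exists (Ordinal lt_j); rewrite // -Shat_class.
  have lt_inf : ((2 * p).-1 < 2 * p)%N by move: p_gt0; lia.
  by exists (Ordinal lt_inf); rewrite // -Shat_inf_class.
case=> k _ ->; have lt_k := ltn_ord k; have [lt_kp | le_pk] := ltnP k p.-1.
  have lt_k1 : (k.+1 < p)%N by move: lt_kp; lia.
  left; apply/setUP; left; apply/imsetP; exists (Ordinal lt_k1).
    by rewrite inE.
  by rewrite /= (@Phat_class k.+1 lt_k) //; congr (D _); apply: val_inj.
have [k_inf | k_fin] := eqVneq (k : nat) (2 * p).-1.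
  have lt_inf : ((2 * p).-1 < 2 * p)%N by rewrite -k_inf.
  right; apply/set1P; rewrite (Shat_inf_class lt_inf); congr (D _).
  exact: val_inj.
have lt_j : (k - p.-1 < p)%N by move: k_fin lt_k le_pk; lia.
have lt_pj : (p.-1 + (k - p.-1) < 2 * p)%N by rewrite subnKC.
left; apply/setUP; right; apply/imsetP; exists (Ordinal lt_j) => //.
rewrite (Shat_class lt_pj lt_j); congr (D _); apply: val_inj.
by rewrite /= subnKC.
Qed.

(** The labels of P_1, ..., P_((p-1)/2) and of S_0, ..., S_((p-1)/2). *)
Definition half_labels : {set 'I_(2 * p)} :=
  [set k : 'I_(2 * p) | (k < (p - 1) %/ 2)%N
                        || (p.-1 <= k < p.-1 + ((p - 1) %/ 2).+1)%N].

Lemma Dhat_classes : Dhat p t x y = \bigcup_(k in half_labels) D k.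
Proof.
apply/setP=> g; apply/setUP/bigcupP.
  case=> /mem_bigcup_nat[i i_range].
    have lt_i : (i.-1 < 2 * p)%N by move: i_range; lia.
    rewrite (Phat_class lt_i) => [Dg|]; last by move: i_range p_gt0; lia.
    by exists (Ordinal lt_i); rewrite // inE /=; apply/orP; left;
      move: i_range; lia.
  have lt_i : (p.-1 + i < 2 * p)%N by move: i_range p_gt0; lia.
  rewrite (Shat_class lt_i) => [Dg|]; last by move: i_range p_gt0; lia.
  by exists (Ordinal lt_i); rewrite // inE /=; apply/orP; right;
    move: i_range; lia.
case=> k; have lt_k := ltn_ord k; rewrite inE => /orP[k_range | k_range] Dg.
  left; apply/mem_bigcup_nat; exists k.+1 => //.
  rewrite (@Phat_class k.+1 lt_k); last by move: k_range; lia.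
  by rewrite (_ : Ordinal _ = k) //; apply: val_inj.
have lt_pj : (p.-1 + (k - p.-1) < 2 * p)%N by case/andP: k_range => /subnKC->.
right; apply/mem_bigcup_nat; exists (k - p.-1)%N; first by lia.
rewrite (Shat_class lt_pj); last by move: k_range p_gt0; lia.
by rewrite (_ : Ordinal _ = k) //; apply: val_inj; rewrite /= subnKC //; lia.
Qed.

(** Half of the total degree q + 1: the (p - 1) / 2 labels of P-classes and the
    (p + 1) / 2 labels of S-classes contribute (q - p) / 2 + (p + 1) / 2. *)
Lemma half_degree :
  (2 * (\sum_(k in half_labels) degree p t lbl P k) = (p ^ t)%:R + 1)%R.
Proof.
under eq_bigr do rewrite degreeE.
set h := ((p - 1) %/ 2)%N.
have def_p : (p = h.*2.+1)%N.
  by rewrite /h subn1 -{1}[p](odd_double_half p) p_odd add1n divn2 /=;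
     rewrite -[in RHS](odd_double_half p) p_odd /= doubleK.
have sum_half : \sum_(k in half_labels)
    ((p.-1 <= k) + (k < p.-1) * (p * geosum p t.-1))%N
    = (h * (p * geosum p t.-1) + h.+1)%N.
  under eq_bigl do rewrite inE; rewrite -/h.
  rewrite -(big_mkord (fun k => (k < h) || (p.-1 <= k < p.-1 + h.+1))%N
    (fun k => (p.-1 <= k) + (k < p.-1) * (p * geosum p t.-1))%N).
  have le1 : (h <= p.-1)%N by lia.
  have le2 : (p.-1 <= p.-1 + h.+1)%N by lia.
  have le3 : (p.-1 + h.+1 <= 2 * p)%N by lia.
  rewrite big_mkcond (big_cat_nat (n := h)) //=; last by lia.
  rewrite (big_cat_nat (m := h) (n := p.-1)) //=; last by lia.
  rewrite (big_cat_nat (m := p.-1) (n := (p.-1 + h.+1)%N)) //=.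
  have -> : \sum_(0 <= k < h) (if (k < h) || (p.-1 <= k < p.-1 + h.+1)
      then (p.-1 <= k) + (k < p.-1) * (p * geosum p t.-1) else 0)%N
      = (h * (p * geosum p t.-1))%N.
    transitivity (\sum_(0 <= k < h) (p * geosum p t.-1))%N; last first.
      by rewrite sum_nat_const_nat subn0.
    apply: eq_big_nat => k /andP[_ lt_k]; have lt_kp := leq_trans lt_k le1.
    by rewrite lt_k /= lt_kp leqNgt lt_kp mul1n.
  rewrite big_nat_cond [X in (_ + (X + _))%N]big1 ?add0n; last first.
    by move=> k; rewrite andbT => /andP[le_k lt_k];
      rewrite ltnNge le_k leqNgt lt_k.
  rewrite [X in (_ + (_ + X))%N]big_nat_cond.
  rewrite [X in (_ + (_ + X))%N]big1 ?addn0; last first.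
    move=> k; rewrite andbT => /andP[le_k _].
    by rewrite [(k < h)%N]ltnNge [(k < p.-1 + _)%N]ltnNge le_k andbF (leq_trans
      _ le_k) //; lia.
  congr (_ + _)%N; transitivity (\sum_(p.-1 <= k < p.-1 + h.+1) 1)%N.
    apply: eq_big_nat => k /andP[le_k lt_k].
    by rewrite le_k lt_k orbT ltnNge le_k.
  by rewrite sum_nat_const_nat addKn muln1.
have -> : (\sum_(k in half_labels)
    ((p.-1 <= k) + (k < p.-1) * (p * geosum p t.-1))%:R =
    (h * (p * geosum p t.-1) + h.+1)%:R :> rat)%R.
  by rewrite -natr_sum sum_half.
have geo n : ((p - 1) * geosum p n + 1 = p ^ n)%N.
  elim: n => [|n IHn]; first by rewrite geosum0 muln0.
  by rewrite geosumS expnS -IHn; move: p_gt0; nia.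
rewrite -natrM -[1%R]/(1%:R)%R -natrD; congr (_%:R)%R.
rewrite -(prednK t_gt0) expnS -(geo t.-1) /=.
by rewrite [in (p - 1)%N]def_p subn1 /= -mul2n; move: def_p; rewrite -mul2n;
  nia.
Qed.

End LeafTree.

Theorem theorem4p6 (p t : nat) (gT : finGroupType) (G : {group gT}) (x y : gT)
    (hp : prime p) (hodd : odd p) (ht : (2 <= t)%N)
    (hG : Ghat_spec p t G x y) :
  [/\ Ghat_sdprod p t G x y,
      amorphic_scheme_on_group G (Ghat_classes p t x y) (2 * p)%N &
      regular_pds G (Dhat p t x y)
        (p ^ (2 * t))%N
        ((p ^ (2 * t) - 1) %/ 2)%N
        ((p ^ (2 * t) - 5) %/ 4)%N
        ((p ^ (2 * t) - 1) %/ 4)%N].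
Proof.
have sdG := sdprod_of_presented hp ht hG; split=> //.
  rewrite (Ghat_classesE hp hodd ht sdG).
  exact: amorphic_leaf_classes.
have -> : (p ^ (2 * t) = (p ^ t) ^ 2)%N by rewrite mulnC expnM.
rewrite (Dhat_classes hp hodd ht sdG).
by apply: pds_leaf_classes => //; apply: half_degree.
Qed.
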